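(* Let $\mathfrak d=\sum_{i=1}^k Q_i(z)\frac{d^i}{dz^i}$ be a high-order Heun operator. Assume that all zeros $\xi_0,\ldots,\xi_k$ of $Q_k$, counted with multiplicity, lie on an affine (real) line in $\mathbb C$. Then the root-counting measures $\mu_n$ of the spectral polynomials $Sp_n$ converge weakly to a probability measure $\mu_Q$ supported on the segment $K_Q=\operatorname{Conv}\{\xi_0,\ldots,\xi_k\}$. This limit depends only on $Q_k$ and not on the lower coefficients $Q_1,\dots,Q_{k-1}$ of $\mathfrak d$. If the line is the real line, then $$\int x\,d\mu_Q(x)=\bar\xi,\qquad \bar\xi=\frac1{k+1}\sum_{j=0}^k\xi_j,$$ and $$\int(x-\bar\xi)^2\,d\mu_Q(x)=\frac{k}{2k+1}\,\frac1{k+1}\sum_{j=0}^k(\xi_j-\bar\xi)^2 .$$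
   Context: Let $k\ge1$. A high-order Heun operator (Fuchs index one) is $\mathfrak d=\sum_{i=1}^kQ_i(z)\frac{d^i}{dz^i}$ with complex polynomials $Q_i$, $\deg Q_i\le i+1$, $\deg Q_k=k+1$. Write $Q_i(z)=\sum_{j=0}^{i+1}q_{i,j}z^j$ and $\lambda_n=\sum_{i=1}^kq_{i,i+1}\,n(n-1)\cdots(n-i+1)$. For given $n$, a Van Vleck polynomial is an at most linear polynomial $V$ such that $(\mathfrak d+V)S=0$ for some polynomial $S$ of degree exactly $n$. For all sufficiently large $n$ these have the form $V_{n,j}(z)=-\lambda_n(z-z_{n,j})$, $j=1,\dots,n+1$, counted with multiplicity, where the multiplicity of a Van Vleck root is its algebraic multiplicity as an eigenvalue of the operator $S\mapsto zS-\lambda_n^{-1}\mathfrak dS$ on the space $\mathrm{Pol}_{\le n}$ of polynomials of degree at most $n$ (this operator preserves $\mathrm{Pol}_{\le n}$). The $n$-th spectral polynomial is $Sp_n(z)=\prod_{j=1}^{n+1}(z-z_{n,j})$ and its root-counting measure is $\mu_n=\frac1{n+1}\sum_{j=1}^{n+1}\delta_{z_{n,j}}$. *)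

(* Defs.v *)
From HB Require Import structures.
From mathcomp Require Import all_boot all_order all_algebra.
From mathcomp Require Import complex.
From mathcomp Require Import all_classical all_reals all_analysis.

Set Implicit Arguments.
Unset Strict Implicit.
Unset Printing Implicit Defensive.

Import Order.TTheory GRing.Theory Num.Theory numFieldNormedType.Exports.

Local Open Scope ring_scope.
Local Open Scope complex_scope.
Local Open Scope classical_set_scope.

(* Only the values Q 1, ..., Q k are used. *)
Definition heun_operator (R : realType) (k : nat) (Q : nat -> {poly R[i]}) :
    Prop :=
  (forall i : nat, (1 <= i <= k)%N -> (size (Q i) <= i.+2)%N) /\
  size (Q k) = k.+2.

Definition diff_op (R : realType) (k : nat) (Q : nat -> {poly R[i]})
    (S : {poly R[i]}) : {poly R[i]} :=
  \sum_(1 <= i < k.+1) Q i * S^`(i).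

Definition heun_lambda (R : realType) (k : nat) (Q : nat -> {poly R[i]})
    (n : nat) : R[i] :=
  \sum_(1 <= i < k.+1) (Q i)`_i.+1 * (n ^_ i)%:R.

Definition van_vleck (R : realType) (k : nat) (Q : nat -> {poly R[i]})
    (n : nat) (V : {poly R[i]}) : Prop :=
  (size V <= 2)%N /\
  exists S : {poly R[i]}, size S = n.+1 /\ diff_op k Q S + V * S = 0.

Definition van_vleck_root (R : realType) (k : nat) (Q : nat -> {poly R[i]})
    (n : nat) (x : R[i]) : Prop :=
  van_vleck k Q n (- heun_lambda k Q n *: ('X - x%:P)).

Definition shifted_op (R : realType) (k : nat) (Q : nat -> {poly R[i]})
    (n : nat) (S : {poly R[i]}) : {poly R[i]} :=
  'X * S - (heun_lambda k Q n)^-1 *: diff_op k Q S.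

(* Matrix, in the monomial basis, of shifted_op on the polynomials of degree
   at most n. As soon as heun_lambda k Q n != 0, that space is stable under
   shifted_op, so that the truncation performed by poly_rV loses nothing. *)
Definition shifted_mx (R : realType) (k : nat) (Q : nat -> {poly R[i]})
    (n : nat) : 'M[R[i]]_n.+1 :=
  lin1_mx (fun v : 'rV[R[i]]_n.+1 =>
    poly_rV (shifted_op k Q n (rVpoly v)) : 'rV[R[i]]_n.+1).

(* The zeros of p, repeated according to multiplicity. *)
Definition poly_roots (R : realType) (p : {poly R[i]}) : seq R[i] :=
  sval (closed_field_poly_normal p).

(* Each Van Vleck root occurs as many times as it does among the roots of the
   characteristic polynomial, i.e. with its algebraic multiplicity as an
   eigenvalue. Values for the finitely many n with heun_lambda k Q n = 0 are
   irrelevant. *)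
Definition van_vleck_roots (R : realType) (k : nat) (Q : nat -> {poly R[i]})
    (n : nat) : seq R[i] :=
  [seq x <- poly_roots (char_poly (shifted_mx k Q n))
     | `[< van_vleck_root k Q n x >]].

Definition spectral_poly (R : realType) (k : nat) (Q : nat -> {poly R[i]})
    (n : nat) : {poly R[i]} :=
  \prod_(x <- van_vleck_roots k Q n) ('X - x%:P).

(* The complex plane with its Borel sigma-algebra; R[i]^o carries the topology
   of the modulus. *)
Notation borelC R := (g_sigma_algebraType (@open (R[i])^o)).

(* Each zero has mass (multiplicity) / (degree of p). *)
Definition root_counting_measure (R : realType) (p : {poly R[i]}) :
    {measure set (borelC R) -> \bar R} :=
  mscale (((size p).-1%:R : R)^-1)%:nng
    (msum (fun i : nat => dirac ((poly_roots p)`_i : borelC R))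
          (size (poly_roots p))).

Definition weakly_converges (R : realType)
    (mu : nat -> {measure set (borelC R) -> \bar R})
    (nu : {measure set (borelC R) -> \bar R}) : Prop :=
  forall f : (R[i])^o -> R, continuous f ->
    (exists M : R, forall z, `|f z| <= M) ->
    (\int[mu n]_z (f z)%:E)%E @[n --> \oo] --> (\int[nu]_z (f z)%:E)%E.

Definition convex_hull (R : realType) (m : nat) (xi : 'I_m -> R[i]) :
    set (borelC R) :=
  [set z | exists t : 'I_m -> R,
     [/\ forall j, 0 <= t j, \sum_j t j = 1 & z = \sum_j (t j)%:C * xi j]].

Definition on_affine_line (R : realType) (m : nat) (xi : 'I_m -> R[i]) : Prop :=
  exists a b : R[i], b != 0 /\ forall j, exists t : R, xi j = a + t%:C * b.

(* Main.v *)
(** The zeros of Sp_n are the eigenvalues of A_n, the matrix of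
    S |-> z S - lambda_n^-1 d S in the monomial basis.

    Localization: if a disc contains the zeros of Q_k, then for large n every
    Van Vleck root lies in a slightly larger disc. Otherwise, at the point
    farthest from the centre among the Van Vleck root and the zeros of S,
    Gauss-Lucas type estimates make Q_k S^(k) dominate the other terms of d S.
    Discs with centres far away on both sides of the line squeeze the roots
    onto the segment.

    Moments: row (t n) of A_n is, up to O(1/n), the sequence of coefficients of
    the Laurent polynomial w - t^k q(w) / w^k, where q is the monic multiple of
    Q_k. Hence tr (A_n^p) / (n + 1) converges to the integral over t in [0, 1]
    of the constant term of (w - t^k q(w) / w^k)^p, which depends only on q and
    is explicit for p = 1, 2.

    By the Weierstrass theorem the means of every continuous function over the
    roots, projected on the line a + R b, converge. The quantile functions of
    the projected roots then converge outside a countable set to a function g,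
    and the limit is the image of Lebesgue measure on [0, 1] under a + b g. *)
Require Import Defs.
From HB Require Import structures.
From mathcomp Require Import all_boot all_order all_algebra.
From mathcomp Require Import complex.
From mathcomp Require Import all_classical all_reals all_analysis.
From mathcomp Require Import measurable_realfun.
From mathcomp Require Import ring lra zify.

Set Implicit Arguments.
Unset Strict Implicit.
Unset Printing Implicit Defensive.

Import Order.TTheory GRing.Theory Num.Theory numFieldNormedType.Exports.
Import ComplexField.Normc.

Local Open Scope ring_scope.
Local Open Scope complex_scope.
Local Open Scope classical_set_scope.

(** * Localization of the Van Vleck roots *)

Section Normc.
Variable R : realType.
Implicit Types x y z : R[i].

(** Integrals of z^p do not determine a measure in the plane, but they do on a line; hence the
    localization. Once the roots are uniformly close to the segment, a continuous test function only
    matters through its restriction to the segment, where polynomials in z approximate it. The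
    condition deg Q_i <= i + 1 serves twice. It bounds the degree of d S by deg S + 1, so that
    lambda_n only has one coefficient to cancel in degree n; and it makes the terms of d S
    comparable in powers of the distance to the centre of a disc, so that the threshold on n depends
    neither on the root nor on S. The lower coefficients drop out because lambda_n has order n^k,
    while for r < k the polynomial Q_r enters row i with weight i (i - 1) ... (i - r + 1) / lambda_n
    = O(1/n). The factor k / (2 k + 1) comes from the integrals of t^k and t^(2 k) over [0, 1]: when
    the zeros have sum 0, the limit second moment is their sum of squares times 1 / (k + 1) - 1 / (2
    k + 1). *)

Lemma normc_ge0 x : 0 <= normc x.
Proof. by case: x => a b; rewrite sqrtr_ge0. Qed.

Lemma normcB x y : normc (x - y) <= normc x + normc y.
Proof. by rewrite -(normcN y); exact: le_normcD. Qed.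

Lemma normc_distC x y : normc (x - y) = normc (y - x).
Proof. by rewrite -normcN opprB. Qed.

Lemma normc_eq0 x : (normc x == 0) = (x == 0).
Proof. by apply/eqP/eqP => [/eq0_normc //|->]; exact: normc0. Qed.

Lemma normc_gt0 x : (0 < normc x) = (x != 0).
Proof. by rewrite lt_neqAle normc_ge0 andbT eq_sym normc_eq0. Qed.

Lemma normcX x n : normc (x ^+ n) = normc x ^+ n.
Proof. by elim: n => [|n IH]; rewrite ?expr0 ?normc1 // !exprS normcM IH. Qed.

Lemma normc_real (a : R) : normc a%:C = `|a|.
Proof. by rewrite /= expr0n /= addr0 sqrtr_sqr. Qed.

Lemma normc_nat n : normc (n%:R : R[i]) = n%:R.
Proof.
have -> : (n%:R : R[i]) = (n%:R : R)%:C by rewrite rmorph_nat.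
by rewrite normc_real ger0_norm.
Qed.

Lemma normc_sum (I : Type) (r : seq I) (P : pred I) (F : I -> R[i]) :
  normc (\sum_(i <- r | P i) F i) <= \sum_(i <- r | P i) normc (F i).
Proof.
elim/big_rec2: _ => [|i y1 y2 _ IH]; first by rewrite normc0.
by apply: (le_trans (le_normcD _ _)); rewrite lerD2l.
Qed.

Lemma normc_prod (I : Type) (r : seq I) (P : pred I) (F : I -> R[i]) :
  normc (\prod_(i <- r | P i) F i) = \prod_(i <- r | P i) normc (F i).
Proof. by apply: (big_morph _ (@normcM R)); exact: normc1. Qed.

Lemma normc_Re x : `|complex.Re x| <= normc x.
Proof.
case: x => a b /=; rewrite -sqrtr_sqr ler_wsqrtr //.
by rewrite lerDl sqr_ge0.
Qed.

Lemma normc_Im x : `|complex.Im x| <= normc x.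
Proof.
case: x => a b /=; rewrite -sqrtr_sqr ler_wsqrtr //.
by rewrite lerDr sqr_ge0.
Qed.

Lemma normc_sqr x : normc x ^+ 2 = complex.Re x ^+ 2 + complex.Im x ^+ 2.
Proof. by case: x => a b /=; rewrite sqr_sqrtr // addr_ge0 // sqr_ge0. Qed.

Lemma lerB_normcD x y : normc x - normc y <= normc (x + y).
Proof.
by rewrite lerBlDr; apply: le_trans (normcB (x + y) y); rewrite addrK.
Qed.

End Normc.

(** * Gauss-Lucas type estimates *)

Section GaussLucas.
Variable R : realType.
Implicit Types (p : {poly R[i]}) (c w : R[i]) (s : seq R[i]).

(** The map zeta |-> 1 / (1 - zeta) sends the closed unit disc minus the point 1 into the half-plane
    Re >= 1/2; here zeta = v / u. *)
Lemma Re_divB_ge (u v : R[i]) : normc v <= normc u -> u != v ->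
  2^-1 <= complex.Re (u / (u - v)).
Proof.
move=> vu uv; have : normc v ^+ 2 <= normc u ^+ 2.
  by rewrite lerXn2r // nnegrE normc_ge0.
rewrite !normc_sqr; case: u v uv vu => [a b] [c d] /= uv _ h.
have pos : 0 < (a - c) ^+ 2 + (b - d) ^+ 2.
  rewrite lt_neqAle addr_ge0 ?sqr_ge0 // andbT eq_sym paddr_eq0 ?sqr_ge0 //.
  rewrite !sqrf_eq0 !subr_eq0; move: uv; rewrite eq_complex /=; by case: eqP.
set D := _ + _ in pos *.
rewrite !mulrN opprK mulrA mulrA -mulrDl ler_pdivlMr //.
rewrite /D; nra.
Qed.

(* At a point of modulus at least that of the roots, every root r contributes
   1 / (w - r) to p'/p, and Re (u / (u - v)) >= 1/2 when |v| <= |u|. *)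
Lemma prod_XsubC_logderiv s c w :
  {in s, forall r, normc (r - c) <= normc (w - c)} ->
  let p := \prod_(r <- s) ('X - r%:P) in p.[w] != 0 ->
  (size s)%:R / 2 <= complex.Re ((w - c) * (p^`().[w] / p.[w])).
Proof.
elim: s => [|r s IH] hs /=.
  by move=> _; rewrite big_nil derivC horner0 !mul0r mulr0.
rewrite big_cons hornerM mulf_eq0 negb_or => /andP[r0 p0].
have hs' : {in s, forall r, normc (r - c) <= normc (w - c)}.
  by move=> x xs; apply: hs; rewrite inE xs orbT.
have := IH hs' p0; set q := \prod_(_ <- _) _ in p0 *.
move=> h; rewrite derivM derivXsubC mul1r hornerD hornerM.
have -> : (q.[w] + ('X - r%:P).[w] * q^`().[w]) / (('X - r%:P).[w] * q.[w])
    = ('X - r%:P).[w]^-1 + q^`().[w] / q.[w].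
  by field; rewrite r0 p0.
rewrite mulrDr raddfD /= -natr1 mulrDl mul1r addrC; apply: lerD => //.
move: r0; rewrite !hornerXsubC => r0.
have -> : w - r = (w - c) - (r - c) by rewrite opprB addrA subrK.
apply: Re_divB_ge; first by apply: hs; rewrite mem_head.
by rewrite -subr_eq0 opprB addrA subrK.
Qed.

(** The modulus of p' / p is bounded below through the real part in [prod_XsubC_logderiv]. At a
    point at least as far from c as all the zeros, differentiation gains a factor of order deg p /
    |w - c|; this makes the highest derivative dominant in the equation. *)
Lemma horner_deriv_ge p c w :
  (forall r, root p r -> normc (r - c) <= normc (w - c)) ->
  (size p).-1%:R * normc p.[w] <= 2 * normc (w - c) * normc p^`().[w].
Proof.
move=> hp; have [->|p0] := eqVneq p 0.
  by rewrite size_poly0 mul0r !mulr_ge0 ?normc_ge0.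
have [pw0|pw0] := eqVneq p.[w] 0.
  by rewrite pw0 normc0 mulr0 !mulr_ge0 ?normc_ge0.
have [s ps] := closed_field_poly_normal p.
have lp : lead_coef p != 0 by rewrite lead_coef_eq0.
have hs : {in s, forall r, normc (r - c) <= normc (w - c)}.
  by move=> r rs; apply: hp; rewrite ps rootZ // root_prod_XsubC.
have := prod_XsubC_logderiv hs; set q := \prod_(_ <- _) _ in ps *.
have qw0 : q.[w] != 0.
  by move: pw0; rewrite ps hornerZ mulf_eq0 negb_or => /andP[].
have -> : (size p).-1 = size s by rewrite ps size_scale // size_prod_XsubC.
move=> /(_ qw0) /= h.
have {h} := le_trans h (le_trans (ler_norm _) (normc_Re _)).
rewrite !normcM normcV mulrA ler_pdivlMr ?normc_gt0 // => h.
rewrite [in leLHS]ps [p in leRHS]ps derivZ !hornerZ !normcM.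
rewrite mulrCA [in leRHS]mulrCA ler_wpM2l ?normc_ge0 //.
by rewrite -[leRHS]mulrA; move: h; lra.
Qed.

Lemma size_deriv_complex p : size (deriv p) = (size p).-1.
Proof.
have [s1|s1] := leqP (size p) 1.
  by rewrite (size1_polyC s1) derivC size_poly0 size_polyC; case: (_ == _).
rewrite /deriv; apply: size_poly_eq.
have -> : (size p).-1.-1.+1 = (size p).-1 by lia.
have p0 : p != 0 by apply: contraTneq s1 => ->; rewrite size_poly0.
by rewrite mulrn_eq0 -lead_coefE lead_coef_eq0 (negbTE p0) orbF; lia.
Qed.

Lemma size_derivn_complex p n : size (derivn n p) = (size p - n)%N.
Proof.
elim: n => [|n IH]; first by rewrite derivn0 subn0.
by rewrite derivnS size_deriv_complex IH subnS.
Qed.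

(** The Gauss-Lucas theorem for a disc: at a zero of p' outside the disc, [horner_deriv_ge] would
    force p to vanish as well. *)
Lemma root_deriv_disc p c (rho : R) :
  (1 < size p)%N -> (forall r, root p r -> normc (r - c) <= rho) ->
  forall r, root (deriv p) r -> normc (r - c) <= rho.
Proof.
move=> p1 hp r /rootP pr; rewrite leNgt; apply/negP => hr.
have h : forall x, root p x -> normc (x - c) <= normc (r - c).
  by move=> x /hp hx; apply: (le_trans hx); exact: ltW.
have := horner_deriv_ge h; rewrite pr normc0 mulr0.
apply/negP; rewrite -ltNge mulr_gt0 ?ltr0n ?normc_gt0 //.
  by rewrite -subn1 subn_gt0.
by apply/negP => /hp; rewrite leNgt hr.
Qed.

Lemma root_derivn_disc p c (rho : R) n :
  (n < size p)%N -> (forall r, root p r -> normc (r - c) <= rho) ->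
  forall r, root (derivn n p) r -> normc (r - c) <= rho.
Proof.
move=> + hp; elim: n => [|n IH] np; first by rewrite derivn0.
rewrite derivnS; apply: root_deriv_disc; last exact/IH/ltnW.
by rewrite size_derivn_complex; lia.
Qed.

(** Iteration of [horner_deriv_ge]: the derivatives keep their zeros in the disc of centre c through
    w, and the degrees met on the way are at least deg p - k, whence a single factor. *)
Lemma horner_derivn_ge p c w (i k : nat) :
  (i <= k)%N -> (k < size p)%N ->
  (forall r, root p r -> normc (r - c) <= normc (w - c)) ->
  ((size p).-1 - k)%:R ^+ (k - i) * normc p^`(i).[w] <=
    (2 * normc (w - c)) ^+ (k - i) * normc p^`(k).[w].
Proof.
move=> ik kp hp; have [m mi] : exists m, (m + i)%N = k.
  by exists (k - i)%N; rewrite subnK.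
have -> : (k - i)%N = m by lia.
elim: m i {ik} mi => [|m IH] i mi; first by rewrite -mi add0n !expr0.
have := IH i.+1; rewrite addnS -addSn => /(_ mi) h.
have ip : (i < size p)%N by lia.
have := horner_deriv_ge (root_derivn_disc ip hp).
rewrite size_derivn_complex -derivnS => h2.
rewrite exprSr -mulrA.
apply: (@le_trans _ _ (((size p).-1 - k)%:R ^+ m *
    (2 * normc (w - c) * normc (derivn i.+1 p).[w]))).
  rewrite ler_wpM2l ?exprn_ge0 //; apply: le_trans h2.
  by rewrite ler_wpM2r ?normc_ge0 // ler_nat; lia.
rewrite mulrCA exprS -[leRHS]mulrA ler_wpM2l //.
by rewrite mulr_ge0 ?normc_ge0.
Qed.

End GaussLucas.

Section Localization.
Variable R : realType.
Implicit Types (p S : {poly R[i]}) (c w a x : R[i]).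

Lemma horner_le_pow p c m (r0 : R) : (size p <= m.+1)%N -> 0 < r0 ->
  exists2 K : R, 0 <= K & forall w, r0 <= normc (w - c) ->
    normc p.[w] <= K * normc (w - c) ^+ m.
Proof.
(* [L] is such that |w| <= L |w - c| whenever |w - c| >= r0; the missing powers of |w - c| are
   supplied by |w - c| / r0 >= 1. *)
move=> pm r00; pose L := 1 + normc c / r0.
have L0 : 0 <= L by rewrite addr_ge0 // divr_ge0 ?normc_ge0 // ltW.
exists (\sum_(i < m.+1) normc p`_i * L ^+ i * r0^-1 ^+ (m - i)).
  apply: sumr_ge0 => i _.
  by rewrite !mulr_ge0 ?normc_ge0 ?exprn_ge0 // invr_ge0 ltW.
move=> w hw; rewrite (horner_coef_wide _ pm).
apply: (le_trans (normc_sum _ _ _)); rewrite mulr_suml; apply: ler_sum => i _.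
rewrite normcM normcX -!mulrA ler_wpM2l ?normc_ge0 //.
have wL : normc w <= L * normc (w - c).
  have -> : w = (w - c) + c by rewrite subrK.
  apply: (le_trans (le_normcD _ _)); rewrite addrK mulrDl mul1r lerD2l.
  by rewrite mulrAC ler_pdivlMr // ler_wpM2l ?normc_ge0.
apply: (@le_trans _ _ (L ^+ i * normc (w - c) ^+ i)).
  by rewrite -exprMn lerXn2r ?nnegrE ?normc_ge0 // mulr_ge0 ?normc_ge0.
rewrite ler_wpM2l ?exprn_ge0 //.
have -> : normc (w - c) ^+ m = normc (w - c) ^+ (m - i) * normc (w - c) ^+ i.
  by rewrite -exprD subnK // -ltnS.
rewrite mulrA ler_peMl ?exprn_ge0 ?normc_ge0 //.
rewrite -exprMn exprn_ege1 // mulrC ler_pdivlMr // mul1r //.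
Qed.

(** Each factor obeys |w - xi j| >= |w - c| - rho >= eps / (rho + eps) |w - c|, the second step
    being |w - c| >= rho + eps. The bound has to grow with |w - c| because w ranges over an
    unbounded set. *)
Lemma horner_prod_XsubC_ge (m : nat) (xi : 'I_m -> R[i]) c (rho eps : R) w :
  0 <= rho -> 0 < eps -> (forall j, normc (xi j - c) <= rho) ->
  rho + eps <= normc (w - c) ->
  (eps / (rho + eps) * normc (w - c)) ^+ m <=
    normc (\prod_j ('X - (xi j)%:P)).[w].
Proof.
move=> rho0 eps0 hxi hw; rewrite horner_prod normc_prod.
have re0 : 0 < rho + eps by lra.
rewrite -[m in leLHS]card_ord -prodr_const; apply: ler_prod => j _.
rewrite mulr_ge0 ?normc_ge0 ?divr_ge0 ?(ltW eps0) ?(ltW re0) //=.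
rewrite hornerXsubC; have -> : w - xi j = (w - c) - (xi j - c).
  by rewrite opprB addrA subrK.
apply: le_trans (lerB_normcD _ _); rewrite normcN.
apply: (@le_trans _ _ (normc (w - c) - rho)); last by rewrite lerB.
have -> : eps / (rho + eps) = 1 - rho / (rho + eps).
  by field; rewrite gt_eqF.
rewrite mulrBl mul1r lerB // mulrAC ler_pdivlMr // ler_wpM2l //.
Qed.

(** Local expansion around a zero of order s: only the coefficient of the lowest power of X - a
    matters later, and r absorbs the rest. *)
Lemma derivn_mulXsubC a p s i : (i <= s)%N ->
  exists r, derivn i (p * ('X - a%:P) ^+ s) =
    (p *+ (s ^_ i) + ('X - a%:P) * r) * ('X - a%:P) ^+ (s - i).
Proof.
elim: i => [|i IH] is_.
  by exists 0; rewrite derivn0 ffactn0 mulr0 addr0 subn0.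
have [r er] := IH (ltnW is_).
exists (deriv p *+ (s ^_ i) + r + ('X - a%:P) * deriv r +
        r *+ (s - i.+1).+1).
rewrite derivnS er derivM derivD derivMn derivM derivXsubC mul1r.
rewrite deriv_exp derivXsubC mul1r /= ffactnSr.
have -> : (s - i)%N = (s - i.+1).+1 by lia.
rewrite mulrnA exprS /=.
have aux (T : comNzRingType) (A A' X q q' E : T) m :
    (A' + (q + X * q')) * (X * E) + (A + X * q) * (E *+ m) =
    (A *+ m + X * (A' + q + X * q' + q *+ m)) * E.
  by rewrite -(mulr_natr E) -(mulr_natr A) -(mulr_natr q); ring.
exact: aux.
Qed.

(* The polynomial S vanishes to some order s > k at w; in the equation only
   the term Q k * S^`(k) vanishes there to order exactly s - k. *)
Lemma diff_op_derivn_neq0 k Q S V w : (0 < k)%N -> S != 0 -> (Q k).[w] != 0 ->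
  diff_op k Q S = V * S -> exists2 i, (i <= k)%N & (derivn i S).[w] != 0.
Proof.
move=> k0 S0 Qk0 dS; apply: contrapT => nS.
have hS i : (i <= k)%N -> (derivn i S).[w] = 0.
  move=> ik; apply/eqP; apply: contrapT => /negP h; apply: nS.
  by exists i.
have [s [q]] := multiplicity_XsubC S w; rewrite S0 /= => qw eS.
have qw0 : q.[w] != 0 by [].
have fact_neq0 i : (i <= s)%N -> ((s ^_ i)%:R : R[i]) != 0.
  by move=> is_; rewrite pnatr_eq0 -lt0n ffact_gt0.
have ks : (k < s)%N.
  rewrite ltnNge; apply/negP => sk; have := hS _ sk.
  have [r] := derivn_mulXsubC w q (leqnn s); rewrite -eS => ->.
  rewrite subnn expr0 mulr1 hornerD hornerM hornerXsubC subrr mul0r addr0.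
  rewrite hornerMn -mulr_natr => /eqP.
  by rewrite mulf_eq0 (negbTE qw0) (negbTE (fact_neq0 _ (leqnn s))).
have h0 : 'X - w%:P != 0 by rewrite -size_poly_eq0 size_XsubC.
pose E := ('X - w%:P) ^+ (s - k).
have [r1 er1] : exists r, \sum_(1 <= i < k) Q i * derivn i S =
    r * ('X - w%:P) * E.
  rewrite big_seq_cond.
  elim/big_rec: _ => [|i p]; first by exists 0; rewrite !mul0r.
  rewrite andbT mem_index_iota => /andP[_ ik] [r ->].
  have [r2] := derivn_mulXsubC w q (ltnW (ltn_trans ik ks)); rewrite -eS => ->.
  exists (Q i * (q *+ s ^_ i + ('X - w%:P) * r2) *
            ('X - w%:P) ^+ (k - i.+1) + r).
  have -> : ('X - w%:P) ^+ (s - i) =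
      ('X - w%:P) ^+ (k - i.+1) * ('X - w%:P) * E.
    by rewrite /E -exprSr -exprD; congr (_ ^+ _); lia.
  have aux (T : comNzRingType) (A B C D F G : T) :
    A * (B * (C * D * F)) + G * D * F = (A * B * C + G) * D * F by ring.
  exact: aux.
have [r2] := derivn_mulXsubC w q (ltnW ks); rewrite -eS => er2.
move: dS; rewrite /diff_op big_nat_recr //= er1 er2 eS -/E => dS.
(* Dividing by [E] and evaluating at w makes the product of Q_k(w), q(w) and s ^_ k vanish, although
   none of the three factors does. *)
have : (Q k * q *+ s ^_ k +
  ('X - w%:P) * (r1 + Q k * r2 - V * q * ('X - w%:P) ^+ k.-1)) * E = 0.
  have e : ('X - w%:P) ^+ s = ('X - w%:P) * ('X - w%:P) ^+ k.-1 * E.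
    by rewrite /E -exprS -exprD; congr (_ ^+ _); lia.
  move: dS; rewrite e => /eqP; rewrite -subr_eq0 => /eqP <-.
  rewrite -[_ *+ _]mulr_natr -[q *+ _]mulr_natr.
  have aux (T : comNzRingType) (A B C D F G H I J : T) :
    (A * B * C + D * (F + A * G - H * B * I)) * J =
    F * D * J + A * ((B * C + D * G) * J) - H * (B * (D * I * J)) by ring.
  exact: aux.
move/eqP; rewrite mulf_eq0 expf_eq0 (negbTE h0) andbF orbF => /eqP.
move/(congr1 (horner^~ w)); rewrite hornerD hornerM hornerXsubC subrr mul0r.
rewrite addr0 hornerMn hornerM horner0 -mulr_natr => /eqP.
by rewrite !mulf_eq0 (negbTE qw0) (negbTE Qk0) (negbTE (fact_neq0 _ (ltnW ks))).
Qed.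

(** Let r = |w - c| and suppose that S^(k)(w) is nonzero. By [horner_derivn_ge] and deg Q_i <= i +
    1, each term with i < k is at most a constant times r^(k+1) |S^(k)(w)| / (n - k), whereas the
    term i = k is at least a constant times r^(k+1) |S^(k)(w)|. The powers of r agree, so the
    threshold on n is uniform in w. Once S^(k)(w) = 0, the same chain of inequalities kills the
    lower derivatives. *)
Lemma derivn_eq0_of_diff_op k Q (xi : 'I_k.+1 -> R[i]) c (rho eps : R) :
  (0 < k)%N -> heun_operator k Q ->
  Q k = lead_coef (Q k) *: \prod_j ('X - (xi j)%:P) ->
  0 <= rho -> 0 < eps -> (forall j, normc (xi j - c) <= rho) ->
  exists N, forall n, (N <= n)%N -> forall S w, size S = n.+1 ->
    rho + eps <= normc (w - c) ->
    (forall r, root S r -> normc (r - c) <= normc (w - c)) ->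
    (diff_op k Q S).[w] = 0 -> forall i, (i <= k)%N -> (derivn i S).[w] = 0.
Proof.
move=> k0 [sQ sQk] hQk rho0 eps0 hxi.
have re0 : 0 < rho + eps by lra.
have /choice[B hB] : forall i, exists B : R, (0 < i <= k)%N -> 0 <= B /\
    forall w, rho + eps <= normc (w - c) ->
      normc (Q i).[w] <= B * normc (w - c) ^+ i.+1.
  move=> i; have [ik|_] := boolP (0 < i <= k)%N; last by exists 0.
  have [B B0 hB] := horner_le_pow c (sQ _ ik) re0.
  by exists B => _; split.
pose q := normc (lead_coef (Q k)).
have q0 : 0 < q by rewrite normc_gt0 lead_coef_eq0 -size_poly_eq0 sQk.
pose th := eps / (rho + eps); have th0 : 0 < th by rewrite divr_gt0.
pose T := \sum_(1 <= i < k) B i * 2 ^+ (k - i).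
pose N := Num.bound `|T / (q * th ^+ k.+1)|.
exists (N + k.+1)%N => n hn S w sS hw hroot hd.
set r := normc (w - c) in hw hroot.
have r0 : 0 < r by exact: lt_le_trans hw.
have nk0 : (0 < n - k)%N by lia.
have chain i : (i <= k)%N -> (n - k)%:R ^+ (k - i) * normc (derivn i S).[w] <=
    (2 * r) ^+ (k - i) * normc (derivn k S).[w].
  move=> ik; have := horner_derivn_ge ik _ hroot; rewrite sS /=; apply.
  by lia.
have Sk0 : (derivn k S).[w] = 0.
  apply: contrapT => /eqP; rewrite -normc_gt0 => Sk.
  have Qkge : q * (th * r) ^+ k.+1 <= normc (Q k).[w].
    rewrite hQk hornerZ normcM ler_wpM2l ?normc_ge0 //.
    exact: horner_prod_XsubC_ge.
  have term i : (1 <= i < k)%N -> (n - k)%:R * normc (Q i * derivn i S).[w] <=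
      B i * 2 ^+ (k - i) * (r ^+ k.+1 * normc (derivn k S).[w]).
    move=> /andP[i1 ik]; rewrite hornerM normcM.
    have [|Bi0 hBi] := hB i; first by rewrite i1 ltnW.
    apply: (@le_trans _ _ (B i * r ^+ i.+1 *
        ((n - k)%:R * normc (derivn i S).[w]))).
      by rewrite mulrCA ler_wpM2r ?mulr_ge0 ?normc_ge0 // hBi.
    apply: (@le_trans _ _ (B i * r ^+ i.+1 *
        ((2 * r) ^+ (k - i) * normc (derivn k S).[w]))).
      rewrite ler_wpM2l ?mulr_ge0 ?exprn_ge0 ?(ltW r0) //.
      apply: le_trans (chain i (ltnW ik)).
      rewrite ler_wpM2r ?normc_ge0 // -[leLHS]expr1 ler_weXn2l ?ler1n //.
      by rewrite subn_gt0.
    have -> : r ^+ k.+1 = r ^+ i.+1 * r ^+ (k - i).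
      by rewrite -exprD addSn subnKC // ltnW.
    by rewrite exprMn le_eqVlt; apply/orP; left; apply/eqP; ring.
  have : (n - k)%:R * normc (Q k * derivn k S).[w] <=
      T * (r ^+ k.+1 * normc (derivn k S).[w]).
    have : (Q k * derivn k S).[w] = - (\sum_(1 <= i < k) Q i * derivn i S).[w].
      apply/eqP; rewrite -addr_eq0 addrC -hornerD; apply/eqP.
      by move: hd; rewrite /diff_op big_nat_recr.
    move=> ->; rewrite normcN horner_sum.
    apply: (@le_trans _ _ ((n - k)%:R *
        \sum_(1 <= i < k) normc (Q i * derivn i S).[w])).
      by rewrite ler_wpM2l // normc_sum.
    rewrite mulr_sumr /T mulr_suml !big_nat; apply: ler_sum => i ik.
    exact: term.
  rewrite hornerM normcM !mulrA ler_pM2r //.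
  apply/negP; rewrite -ltNge.
  apply: (@lt_le_trans _ _ ((n - k)%:R * (q * (th * r) ^+ k.+1))); last first.
    by rewrite ler_wpM2l.
  rewrite exprMn !mulrA ltr_pM2r ?exprn_gt0 // -mulrA.
  rewrite -ltr_pdivrMr ?mulr_gt0 ?exprn_gt0 //.
  apply: (@lt_le_trans _ _ N%:R).
    by apply: le_lt_trans (ler_norm _) (archi_boundP _).
  by rewrite ler_nat; clearbody N; clear -hn; lia.
move=> i ik; apply/eqP; rewrite -normc_eq0 eq_le normc_ge0 andbT.
have := chain i ik; rewrite Sk0 normc0 mulr0 pmulr_rle0 //.
by rewrite exprn_gt0 // ltr0n.
Qed.

(* zeta is the farthest from c among x and the zeros of S, so that the equation
   makes diff_op k Q S vanish there. *)
Lemma van_vleck_root_disc k Q (xi : 'I_k.+1 -> R[i]) c (rho eps : R) :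
  (0 < k)%N -> heun_operator k Q ->
  Q k = lead_coef (Q k) *: \prod_j ('X - (xi j)%:P) ->
  0 <= rho -> 0 < eps -> (forall j, normc (xi j - c) <= rho) ->
  exists N, forall n, (N <= n)%N -> forall x, van_vleck_root k Q n x ->
    normc (x - c) < rho + eps.
Proof.
move=> k0 hQ hQk rho0 eps0 hxi.
have [N hN] := derivn_eq0_of_diff_op k0 hQ hQk rho0 eps0 hxi.
exists N => n Nn x [_ [S [sS]]] /eqP; rewrite addr_eq0 => /eqP dS.
rewrite ltNge; apply/negP => hx.
have S0 : S != 0 by rewrite -size_poly_eq0 sS.
have [s Ss] := closed_field_poly_normal S.
have [z] : exists2 z, z \in x :: s &
    {in x :: s, forall y, normc (y - c) <= normc (z - c)}.
  elim: s {Ss} => [|y s [z zs hz]].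
    by exists x; rewrite ?mem_head // => y; rewrite inE => /eqP ->.
  have [yz|yz] := leP (normc (y - c)) (normc (z - c)).
    exists z; first by move: zs; rewrite !inE => /orP[->//|->]; rewrite !orbT.
    move=> t; rewrite !inE => /or3P[/eqP ->|/eqP ->//|ts].
      by apply: hz; rewrite mem_head.
    by apply: hz; rewrite inE ts orbT.
  exists y; first by rewrite !inE eqxx orbT.
  move=> t; rewrite !inE => /or3P[/eqP ->|/eqP ->//|ts].
    by apply: le_trans (ltW yz); apply: hz; rewrite mem_head.
  by apply: le_trans (ltW yz); apply: hz; rewrite inE ts orbT.
move=> zs hz.
have xz : rho + eps <= normc (z - c).
  by apply: (le_trans hx); apply: hz; rewrite mem_head.
have rS r : root S r = (r \in s).
  by rewrite Ss rootZ ?lead_coef_eq0 // root_prod_XsubC.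
have hroot r : root S r -> normc (r - c) <= normc (z - c).
  by rewrite rS => rs; apply: hz; rewrite inE rs orbT.
have Qkz : (Q k).[z] != 0.
  rewrite hQk hornerZ mulf_neq0 //.
    by rewrite lead_coef_eq0 -size_poly_eq0 hQ.2.
  rewrite -normc_gt0; apply: lt_le_trans (horner_prod_XsubC_ge rho0 eps0 hxi xz).
  rewrite exprn_gt0 // mulr_gt0 ?divr_gt0 //; lra.
have [i ik] := diff_op_derivn_neq0 k0 S0 Qkz (etrans dS (esym (mulNr _ _))).
rewrite (hN _ Nn _ _ sS xz hroot) ?eqxx // dS hornerN hornerM hornerZ hornerXsubC.
move: zs; rewrite inE => /orP[/eqP ->|]; first by rewrite subrr mulr0 mul0r oppr0.
by rewrite -rS => /rootP ->; rewrite mulr0 oppr0.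
Qed.

End Localization.

(** * Falling factorials and the growth of lambda_n *)

Section Ffact.

Lemma leq_ffact m n k : (m <= n)%N -> (m ^_ k <= n ^_ k)%N.
Proof.
elim: k m n => [//|k IH] [|m] [|n] // mn.
by rewrite !ffactSS leq_mul // IH.
Qed.

Lemma ffact_le_expn m k : (m ^_ k <= m ^ k)%N.
Proof.
elim: k => [//|k IH]; rewrite ffactnSr expnSr leq_mul //; exact: leq_subr.
Qed.

Lemma expn_le_ffact m k : (m ^ k <= m ^_ k + k ^ 2 * m ^ k.-1)%N.
Proof.
elim: k => [//|[|k] IH]; first by rewrite ffactn1; lia.
rewrite ffactnSr /=; move: IH => /=; have := ffact_le_expn m k.+1.
rewrite !expnS expn0; set a := (m ^ k)%N; set b := (m ^_ k.+1)%N; nia.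
Qed.

(** A discrete mean value inequality. The factor n - m is kept because m may be close to n when
    lambda_m and lambda_n are compared. *)
Lemma ffact_sub_le m n k : (m <= n)%N ->
  (n ^_ k <= m ^_ k + (n - m) * k * n ^ k.-1)%N.
Proof.
move=> mn; elim: k => [//|k IH].
rewrite !ffactnSr.
have mF : (m ^_ k <= n ^ k)%N.
  apply: leq_trans (ffact_le_expn m k) _.
  by case: k {IH} => // k; rewrite leq_exp2r.
have kE : (k * n ^ k.-1 * (n - k) <= k * n ^ k)%N.
  case: k {IH mF} => // k; rewrite -mulnA expnSr.
  by rewrite !leq_mul2l leq_subr !orbT.
apply: leq_trans (leq_mul IH (leqnn (n - k))) _.
rewrite mulnDl -[((n - m) * k * _ * _)%N]mulnA -[((n - m) * k * _)%N]mulnA.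
have h1 : (m ^_ k * (n - k) <= m ^_ k * (m - k) + (n - m) * n ^ k)%N.
  rewrite [X in (_ <= _ + X)%N]mulnC.
  apply: leq_trans (leq_add (leqnn _) (leq_mul mF (leqnn _))).
  by rewrite -mulnDr leq_mul2l; apply/orP; right; lia.
have h2 : ((n - m) * (k * (n ^ k.-1 * (n - k))) <= (n - m) * (k * n ^ k))%N.
  by rewrite leq_mul2l mulnA kE orbT.
apply: leq_trans (leq_add h1 h2) _.
by rewrite -addnA -[((n - m) * k.+1 * _)%N]mulnA mulSn mulnDr.
Qed.

(** Yields n ^_ k - m ^_ k >= (1 - m / n) n ^_ k, again proportional to n - m. *)
Lemma ffact_ratio_le m n k : (m <= n)%N -> (0 < k)%N ->
  (n * m ^_ k <= m * n ^_ k)%N.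
Proof.
case: k => // k mn _; rewrite !ffactnS !mulnA (mulnC m n) leq_mul2l leq_ffact ?orbT //.
lia.
Qed.

End Ffact.

Section HeunLambda.
Variables (R : realType) (k : nat) (Q : nat -> {poly R[i]}).
Hypotheses (k0 : (0 < k)%N) (hQ : heun_operator k Q).

Let q := (Q k)`_k.+1.
Let C := \sum_(1 <= i < k) normc (Q i)`_i.+1 * i%:R.

Lemma heun_lead_neq0 : q != 0.
Proof.
by rewrite /q; have := hQ.2 => e; rewrite -[k.+1]/(k.+2.-1) -e -lead_coefE
  lead_coef_eq0 -size_poly_eq0 e.
Qed.

Lemma heun_lambdaE n : heun_lambda k Q n =
  q * (n ^_ k)%:R + \sum_(1 <= i < k) (Q i)`_i.+1 * (n ^_ i)%:R.
Proof. by rewrite /heun_lambda big_nat_recr //= addrC. Qed.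

(** If lambda_m = lambda_n, the leading parts differ by at least |q| (n - m) n^(k-1) (1 - k^2 / n),
    and the other terms by at most C (n - m) n^(k-2). The factor n - m cancels, so the threshold
    does not depend on m. *)
Lemma heun_lambda_inj : exists N, forall n, (N <= n)%N -> forall m, (m < n)%N ->
  heun_lambda k Q m != heun_lambda k Q n.
Proof.
have q0 : 0 < normc q by rewrite normc_gt0 heun_lead_neq0.
exists (k ^ 2 + Num.bound `|C / normc q|)%N => n nN m mn; apply/negP => /eqP.
rewrite !heun_lambdaE => /eqP; rewrite -subr_eq0 opprD addrACA -mulrBr -sumrB.
rewrite addr_eq0 => /eqP/(congr1 (@normc R)); rewrite normcN normcM.
set B := \sum_(_ <= _ < _) _ => eB.
have n0 : (0 < n)%N by exact: leq_ltn_trans mn.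
have n0R : 0 < n%:R :> R by rewrite ltr0n.
have nm0 : 0 < (n - m)%:R :> R by rewrite ltr0n subn_gt0.
have lower : n%:R * normc B <= C * ((n - m)%:R * n%:R ^+ k.-1).
  apply: (@le_trans _ _ (n%:R * \sum_(1 <= i < k)
      normc ((Q i)`_i.+1 * (m ^_ i)%:R - (Q i)`_i.+1 * (n ^_ i)%:R))).
    by rewrite ler_wpM2l // normc_sum.
  rewrite /C mulr_sumr mulr_suml !big_nat; apply: ler_sum => i /andP[i1 ik].
  rewrite -mulrBr normcM mulrCA -mulrA ler_wpM2l ?normc_ge0 //.
  rewrite normc_distC -natrB ?leq_ffact 1?ltnW // normc_nat -!natrX -!natrM.
  rewrite ler_nat.
  have := ffact_sub_le i (ltnW mn); rewrite -leq_subLR => h.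
  apply: leq_trans (leq_mul (leqnn n) h) _.
  have -> : (n * ((n - m) * i * n ^ i.-1) = i * ((n - m) * n ^ i))%N.
    have -> : (n ^ i = n * n ^ i.-1)%N by rewrite -expnS prednK.
    by move: (n ^ i.-1)%N (n - m)%N => a b; nia.
  rewrite leq_mul2l leq_mul2l leq_pexp2l ?orbT //; lia.
have upper : normc q * ((n - m)%:R * (n%:R ^+ k.-1 * (n%:R - (k ^ 2)%:R))) <=
    n%:R * normc B.
  rewrite -eB [leRHS]mulrCA ler_wpM2l ?normc_ge0 // normc_distC.
  rewrite -natrB; last by apply: leq_trans nN; exact: leq_addr.
  rewrite -natrB ?leq_ffact 1?ltnW // normc_nat.
  rewrite -!natrX -!natrM ler_nat.
  have := expn_le_ffact n k; have := ffact_ratio_le (ltnW mn) k0.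
  have := leq_ffact k (ltnW mn).
  have -> : (n ^ k = n ^ k.-1 * n)%N by rewrite -expnSr prednK.
  move: (n ^_ k)%N (m ^_ k)%N (n ^ k.-1)%N (k ^ 2)%N => a b E K h1 h2 h3.
  have h4 : ((n - m) * (E * (n - K)) <= (n - m) * a)%N.
    by rewrite leq_mul2l; apply/orP; right; rewrite mulnBr; lia.
  by apply: leq_trans h4 _; rewrite mulnBl mulnBr leq_sub2l.
have E0 : 0 < (n - m)%:R * n%:R ^+ k.-1 :> R by rewrite mulr_gt0 // exprn_gt0.
have : normc q * (n%:R - (k ^ 2)%:R) * ((n - m)%:R * n%:R ^+ k.-1) <=
    C * ((n - m)%:R * n%:R ^+ k.-1).
  apply: le_trans lower; apply: le_trans upper.
  by rewrite le_eqVlt; apply/orP; left; apply/eqP; ring.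
rewrite ler_pM2r //; apply/negP; rewrite -ltNge mulrC -ltr_pdivrMr //.
apply: (@lt_le_trans _ _ (Num.bound `|C / normc q|)%:R).
  exact: le_lt_trans (ler_norm _) (archi_boundP _).
by rewrite lerBrDr -natrD ler_nat addnC.
Qed.

Lemma heun_lambda_asymp : exists2 B : R, 0 <= B & forall n,
  normc (heun_lambda k Q n - q * n%:R ^+ k) <= B * n%:R ^+ k.-1.
Proof.
exists (normc q * (k ^ 2)%:R + \sum_(1 <= i < k) normc (Q i)`_i.+1).
  by rewrite addr_ge0 ?mulr_ge0 ?normc_ge0 // sumr_ge0 // => *; exact: normc_ge0.
move=> n; rewrite heun_lambdaE addrAC -mulrBr mulrDl.
apply: (le_trans (le_normcD _ _)); rewrite normcM; apply: lerD.
  rewrite -mulrA ler_wpM2l ?normc_ge0 // normc_distC -natrX.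
  rewrite -natrB ?ffact_le_expn // normc_nat -natrX -natrM ler_nat.
  by rewrite leq_subLR expn_le_ffact.
apply: (le_trans (normc_sum _ _ _)); rewrite mulr_suml !big_nat.
apply: ler_sum => i /andP[i1 ik]; rewrite normcM ler_wpM2l ?normc_ge0 //.
rewrite normc_nat -natrX ler_nat; apply: leq_trans (ffact_le_expn n i) _.
have [->|n0] := posnP n; first by rewrite exp0n.
rewrite leq_pexp2l //; lia.
Qed.

Lemma heun_lambda_ge : exists N, forall n, (N <= n)%N ->
  normc q / 2 * n%:R ^+ k <= normc (heun_lambda k Q n).
Proof.
have q0 : 0 < normc q by rewrite normc_gt0 heun_lead_neq0.
have [B B0 hB] := heun_lambda_asymp.
exists (Num.bound (2 * B / normc q)) => n nN.
have hn : 2 * B / normc q <= n%:R.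
  apply: (@le_trans _ _ (Num.bound (2 * B / normc q))%:R); last by rewrite ler_nat.
  by apply/ltW/archi_boundP; rewrite divr_ge0 ?mulr_ge0 ?normc_ge0.
have := lerB_normcD (q * n%:R ^+ k) (heun_lambda k Q n - q * n%:R ^+ k).
rewrite [X in _ <= normc X]addrC subrK; apply: le_trans.
have := hB n; rewrite normcM normcX normc_nat => h.
have e : n%:R ^+ k = n%:R * n%:R ^+ k.-1 :> R by rewrite -exprS prednK.
have E0 : 0 <= n%:R ^+ k.-1 :> R by rewrite exprn_ge0.
have : B * n%:R ^+ k.-1 <= normc q / 2 * (n%:R * n%:R ^+ k.-1).
  rewrite mulrA ler_wpM2r //; move: hn; rewrite ler_pdivrMr //; lra.
rewrite e; move: h; lra.
Qed.

End HeunLambda.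

(** * Van Vleck roots as eigenvalues *)

Lemma coefM_top (A : nzRingType) (p q : {poly A}) a b :
  (size p <= a.+1)%N -> (size q <= b.+1)%N -> (p * q)`_(a + b) = p`_a * q`_b.
Proof.
move=> pa qb; rewrite coefM.
have ia : (a < (a + b).+1)%N by rewrite ltnS leq_addr.
rewrite (bigD1 (Ordinal ia)) //= addKn big1 ?addr0 // => j ja.
have [jlt|jle] := ltnP j a.
  rewrite [q`__]nth_default ?mulr0 //; apply: leq_trans qb _.
  lia.
have aj : (a < j)%N.
  by rewrite ltn_neqAle jle andbT eq_sym; apply: contraNneq ja => e; exact/eqP/val_inj.
by rewrite [p`__]nth_default ?mul0r //; exact: leq_trans aj.
Qed.

Section ShiftedOp.
Variables (R : realType) (k : nat) (Q : nat -> {poly R[i]}).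
Hypothesis hQ : heun_operator k Q.

Lemma diff_op_linear (a : R[i]) (S T : {poly R[i]}) :
  diff_op k Q (a *: S + T) = a *: diff_op k Q S + diff_op k Q T.
Proof.
rewrite /diff_op scaler_sumr -big_split /=; apply: eq_bigr => i _.
by rewrite derivnD derivnZ mulrDr scalerAr.
Qed.

Lemma size_mul_derivn i m (S : {poly R[i]}) : (1 <= i <= k)%N ->
  (size S <= m.+1)%N -> (size (Q i * derivn i S)%R <= m.+2)%N.
Proof.
move=> ik Sm; have [mi|im] := ltnP m i.
  have -> : derivn i S = 0.
    by apply/size_poly_leq0P; rewrite size_derivn_complex leqn0; lia.
  by rewrite mulr0 size_poly0.
apply: leq_trans (size_polyMleq _ _) _.
by have := hQ.1 _ ik; rewrite size_derivn_complex; lia.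
Qed.

Lemma size_diff_op m (S : {poly R[i]}) :
  (size S <= m.+1)%N -> (size (diff_op k Q S) <= m.+2)%N.
Proof.
move=> Sm; rewrite /diff_op big_nat.
elim/big_ind: _ => [|p q hp hq|i ik]; first by rewrite size_poly0.
  by apply: leq_trans (size_polyD _ _) _; rewrite geq_max hp.
exact: size_mul_derivn.
Qed.

Lemma coef_diff_op m (S : {poly R[i]}) :
  (size S <= m.+1)%N -> (diff_op k Q S)`_m.+1 = heun_lambda k Q m * S`_m.
Proof.
move=> Sm; rewrite /diff_op /heun_lambda coef_sum mulr_suml !big_nat.
apply: eq_bigr => i ik; have [mi|im] := ltnP m i.
  have -> : derivn i S = 0.
    by apply/size_poly_leq0P; rewrite size_derivn_complex leqn0; lia.
  by rewrite mulr0 coef0 ffact_small // mulr0 mul0r.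
have -> : m.+1 = (i.+1 + (m - i))%N by rewrite addSn subnKC.
rewrite coefM_top ?(hQ.1 _ ik) //; last by rewrite size_derivn_complex; lia.
by rewrite coef_derivn subnKC // mulr_natr mulrnAl mulrnAr.
Qed.

Lemma shifted_opP n (a : R[i]) (S T : {poly R[i]}) :
  shifted_op k Q n (a *: S + T) = a *: shifted_op k Q n S + shifted_op k Q n T.
Proof.
rewrite /shifted_op diff_op_linear scalerBr mulrDr scalerDr -scalerAr opprD.
by rewrite addrACA [_^-1 *: (a *: _)]scalerA [_^-1 * a]mulrC -scalerA.
Qed.

Lemma shifted_op_linear n : linear (fun v : 'rV[R[i]]_n.+1 =>
  poly_rV (shifted_op k Q n (rVpoly v)) : 'rV[R[i]]_n.+1).
Proof. by move=> a u v; rewrite linearP shifted_opP linearP. Qed.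

Lemma mul_shifted_mx n (v : 'rV[R[i]]_n.+1) :
  v *m shifted_mx k Q n = poly_rV (shifted_op k Q n (rVpoly v)).
Proof.
pose f := fun v : 'rV[R[i]]_n.+1 =>
  poly_rV (shifted_op k Q n (rVpoly v)) : 'rV[R[i]]_n.+1.
pose F : {linear 'rV[R[i]]_n.+1 -> 'rV[R[i]]_n.+1} :=
  HB.pack f (GRing.isLinear.Build _ _ _ _ f (@shifted_op_linear n)).
exact: (mul_rV_lin1 F v).
Qed.

Lemma shifted_mxE n (i j : 'I_n.+1) :
  shifted_mx k Q n i j = (shifted_op k Q n 'X^i)`_j.
Proof.
have := mul_shifted_mx (delta_mx 0 i); rewrite -rowE => /rowP/(_ j).
by rewrite !mxE rVpoly_delta.
Qed.

(* The coefficient of degree m + 1 of shifted_op S, for S of degree m, is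
   (1 - lambda_m / lambda_n) S_m: no eigenvector has degree m < n. *)
Lemma eigen_van_vleck_root n x :
  heun_lambda k Q n != 0 ->
  (forall m, (m < n)%N -> heun_lambda k Q m != heun_lambda k Q n) ->
  root (char_poly (shifted_mx k Q n)) x -> van_vleck_root k Q n x.
Proof.
move=> l0 linj; rewrite -eigenvalue_root_char => /eigenvalueP[v].
rewrite mul_shifted_mx => ev v0; pose S := rVpoly v.
have S0 : S != 0 by apply: contraNneq v0 => e; rewrite -(rVpolyK v) -/S e linear0.
have sS : (size S <= n.+1)%N by exact: size_poly.
have hop : shifted_op k Q n S = x *: S.
  have := congr1 (@rVpoly _ _) ev; rewrite linearZ /= -/S => <-.
  rewrite poly_rV_K //; have : (size (shifted_op k Q n S) <= n.+2)%N.
    apply: leq_trans (size_polyD _ _) _; rewrite geq_max size_polyN.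
    apply/andP; split; last first.
      by apply: leq_trans (size_scale_leq _ _) _; exact: size_diff_op.
    by apply: leq_trans (size_polyMleq _ _) _; rewrite size_polyX.
  rewrite leq_eqVlt => /predU1P[e|//].
  have : lead_coef (shifted_op k Q n S) = 0.
    rewrite lead_coefE e /= coefB coefXM /= coefZ coef_diff_op // mulKf //.
    by rewrite subrr.
  by move/eqP; rewrite lead_coef_eq0 -size_poly_eq0 => /eqP ->.
have Sn : size S = n.+1.
  apply/eqP; rewrite eqn_leq sS leqNgt; apply/negP => Slt.
  have : (0 < size S)%N by rewrite size_poly_gt0.
  case eSm : (size S) Slt => [//|m]; rewrite ltnS => mn _.
  have := congr1 (fun p : {poly R[i]} => p`_m.+1) hop.
  rewrite coefZ [in RHS]nth_default ?eSm // mulr0 coefB coefXM /= coefZ.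
  rewrite coef_diff_op ?eSm // => /eqP; rewrite mulrA -{1}[S`_m]mul1r -mulrBl.
  have : lead_coef S != 0 by rewrite lead_coef_eq0.
  rewrite lead_coefE eSm /= => Sm0; rewrite mulf_eq0 (negbTE Sm0) orbF subr_eq0.
  move=> /eqP e; have := linj _ mn; apply/negP; rewrite negbK.
  by apply/eqP/(mulfI (invr_neq0 l0)); rewrite -e mulVf.
split.
  apply: leq_trans (size_scale_leq _ _) _; by rewrite size_XsubC.
exists S; split => //.
have e : (heun_lambda k Q n)^-1 *: diff_op k Q S = 'X * S - x *: S.
  by rewrite -hop /shifted_op opprB addrCA subrr addr0.
have -> : diff_op k Q S = heun_lambda k Q n *: ('X * S - x *: S).
  by rewrite -e scalerA divff // scale1r.
by rewrite -scalerAl mulrBl mul_polyC scaleNr subrr.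
Qed.

End ShiftedOp.

Lemma trig_mx_exp (A : comNzRingType) n (T : 'M[A]_n.+1) p : is_trig_mx T ->
  is_trig_mx (T ^+ p) /\ forall i, (T ^+ p) i i = T i i ^+ p.
Proof.
move=> /is_trig_mxP hT; elim: p => [|p [/is_trig_mxP hp dp]].
  split=> [|i]; last by rewrite !expr0 mxE eqxx.
  by apply/is_trig_mxP => i j ij; rewrite expr0 mxE; case: eqP ij => // ->; rewrite ltnn.
rewrite exprS; split=> [|i].
  apply/is_trig_mxP => i j ij; rewrite mxE big1 // => l _.
  have [il|li] := ltnP i l; first by rewrite hT // mul0r.
  by rewrite hp ?mulr0 //; exact: leq_ltn_trans ij.
rewrite mxE (bigD1 i) //= dp -exprS big1 ?addr0 // => l li.
have [il|] := ltnP i l; first by rewrite hT // mul0r.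
by rewrite leq_eqVlt => /predU1P[e|li']; [case/eqP: li; apply: val_inj | rewrite hp // mulr0].
Qed.

Lemma char_poly_conj (A : comUnitRingType) n (P M : 'M[A]_n) : P \in unitmx ->
  char_poly (P *m M *m invmx P) = char_poly M.
Proof.
move=> Pu; rewrite /char_poly /char_poly_mx.
have -> : 'X%:M - map_mx polyC (P *m M *m invmx P) =
    map_mx polyC P *m ('X%:M - map_mx polyC M) *m map_mx polyC (invmx P).
  rewrite !map_mxM mulmxBr mulmxBl; congr (_ - _).
  by rewrite scalar_mxC -mulmxA -map_mxM mulmxV // map_mx1 mulmx1.
by rewrite !det_mulmx mulrAC -det_mulmx -map_mxM mulmxV // map_mx1 det1 mul1r.
Qed.

Lemma poly_rootsE (R : realType) (p : {poly R[i]}) : p \is monic ->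
  p = \prod_(x <- poly_roots p) ('X - x%:P).
Proof.
rewrite /poly_roots => /monicP pm; case: closed_field_poly_normal => s /= e.
by rewrite [LHS]e pm scale1r.
Qed.

(** In a Schur triangularization the diagonal lists the roots of the characteristic polynomial with
    multiplicity, and the diagonal of a power consists of the powers. *)
Lemma sum_roots_char_poly (R : realType) n (A : 'M[R[i]]_n.+1) p :
  \sum_(x <- poly_roots (char_poly A)) x ^+ p = \tr (A ^+ p).
Proof.
have [P Pu] := Schur A (ltn0Sn n); have Pn := unitarymx_unit Pu.
rewrite /similar_to /= conjumx // => hT; set T := P *m A *m invmx P in hT.
have -> : \tr (A ^+ p) = \tr (T ^+ p).
  have -> : T ^+ p = P *m A ^+ p *m invmx P.
    elim: p => [|p IH]; first by rewrite !expr0 mulmx1 mulmxV.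
    by rewrite exprS IH exprS /T -!mulmxE !mulmxA mulmxKV.
  by rewrite mxtrace_mulC mulmxA mulVmx // mul1mx.
have [_ dT] := trig_mx_exp p hT.
have pe :
    perm_eq (poly_roots (char_poly A)) [seq T i i | i <- enum 'I_n.+1].
  apply: prod_XsubC_eq; rewrite -poly_rootsE ?char_poly_monic // -(char_poly_conj A Pn).
  by rewrite (char_poly_trig hT) big_map big_enum.
by rewrite (perm_big _ pe) big_map big_enum /=; apply: eq_bigr => i _; rewrite dT.
Qed.

(** For large n every eigenvalue is a Van Vleck root, so the filter in [van_vleck_roots] discards
    nothing and the spectral polynomial is the characteristic polynomial; its power sums are then
    traces. *)
Lemma spectral_roots (R : realType) k (Q : nat -> {poly R[i]}) : (0 < k)%N ->
  heun_operator k Q -> exists N, forall n, (N <= n)%N ->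
  let s := poly_roots (spectral_poly k Q n) in
  [/\ size (spectral_poly k Q n) = n.+2, size s = n.+1,
    {in s, forall x, van_vleck_root k Q n x} &
    forall p, \sum_(x <- s) x ^+ p = \tr (shifted_mx k Q n ^+ p)].
Proof.
move=> k0 hQ; have [N1 h1] := heun_lambda_inj k0 hQ.
have [N2 h2] := heun_lambda_ge k0 hQ.
exists (N1 + N2).+1 => n nN s.
have l0 : heun_lambda k Q n != 0.
  rewrite -normc_gt0; apply: lt_le_trans (h2 n _); last by lia.
  rewrite mulr_gt0 ?divr_gt0 ?normc_gt0 ?exprn_gt0 ?ltr0n ?heun_lead_neq0 //.
  lia.
have linj : forall m, (m < n)%N -> heun_lambda k Q m != heun_lambda k Q n.
  by apply: h1; lia.
pose c := char_poly (shifted_mx k Q n).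
have cm : c \is monic := char_poly_monic _.
have croot x : x \in poly_roots c -> van_vleck_root k Q n x.
  move=> xs; apply: (eigen_van_vleck_root hQ l0 linj).
  by rewrite -/c (poly_rootsE cm) root_prod_XsubC.
have ec : spectral_poly k Q n = c.
  rewrite [RHS](poly_rootsE cm) /spectral_poly /van_vleck_roots -/c.
  congr (\prod_(x <- _) _); apply/all_filterP/allP => x xs.
  exact/asboolP/croot.
have sc : size c = n.+2 by rewrite size_char_poly.
have ss : size (poly_roots c) = n.+1.
  have := congr1 (fun p : {poly R[i]} => size p) (poly_rootsE cm).
  by rewrite sc size_prod_XsubC => -[].
rewrite /s ec; split => //; exact: sum_roots_char_poly.
Qed.

(** * Limits of the normalized traces *)

Section L1.
Variable R : realType.
Implicit Types P : {poly R[i]}.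

(** The l^1 norm of the coefficients. Multiplication by a power of the variable leaves it unchanged,
    hence it bounds the rows of the matrices uniformly in the row index. *)
Definition coef_norm P : R := \sum_(s < size P) normc P`_s.

Lemma coef_norm_ge0 P : 0 <= coef_norm P.
Proof. by rewrite sumr_ge0 // => s _; exact: normc_ge0. Qed.

Lemma sum_coef_le P m : \sum_(s < m) normc P`_s <= coef_norm P.
Proof.
rewrite /coef_norm; have [sm|ms] := leqP (size P) m.
  rewrite (big_ord_widen _ (fun s => normc P`_s) sm)
    [leLHS](bigID (fun s : 'I_m => (s < size P)%N)) /=.
  rewrite [X in _ + X]big1 ?addr0 // => s; rewrite -leqNgt => h.
  by rewrite nth_default // normc0.
rewrite (big_ord_widen _ (fun s => normc P`_s) (ltnW ms)).
by rewrite [leRHS](bigID (fun s : 'I_(size P) => (s < m)%N)) /=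
  lerDl sumr_ge0 // => s _; exact: normc_ge0.
Qed.

Lemma coef_normXnM P i : coef_norm ('X^i * P) = coef_norm P.
Proof.
have [->|P0] := eqVneq P 0; first by rewrite mulr0.
rewrite /coef_norm size_monicM ?monicXn // size_polyXn /= big_split_ord /=.
rewrite big1 ?add0r => [|s _]; last by rewrite coefXnM /= ltn_ord normc0.
by apply: eq_bigr => s _; rewrite coefXnM /= ltnNge leq_addr /= addKn.
Qed.

Lemma sum_coef_shift_le P i r m :
  \sum_(l < m) normc ('X^i * P)`_(l + r) <= coef_norm P.
Proof.
rewrite -(coef_normXnM P i); apply: le_trans (sum_coef_le _ (r + m)).
rewrite big_split_ord /= (eq_bigr (fun l : 'I_m => normc ('X^i * P)`_(r + l))).
  by rewrite lerDr sumr_ge0 // => s _; exact: normc_ge0.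
by move=> l _; rewrite addnC.
Qed.

Lemma normc_coef_le P s : normc P`_s <= coef_norm P.
Proof.
apply: le_trans (sum_coef_le P s.+1); rewrite big_ord_recr /= lerDr.
by rewrite sumr_ge0 // => i _; exact: normc_ge0.
Qed.

Lemma normc_horner_le P t : normc t <= 1 -> normc P.[t] <= coef_norm P.
Proof.
move=> t1; rewrite horner_coef; apply: (le_trans (normc_sum _ _ _)).
apply: ler_sum => s _; rewrite normcM normcX ler_piMr ?normc_ge0 //.
by rewrite exprn_ile1 ?normc_ge0.
Qed.

Lemma normc_hornerB_le P t u : normc t <= 1 -> normc u <= 1 ->
  normc (P.[t] - P.[u]) <= (coef_norm P * (size P)%:R) * normc (t - u).
Proof.
move=> t1 u1; rewrite !horner_coef -sumrB; apply: (le_trans (normc_sum _ _ _)).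
rewrite /coef_norm -mulrA mulr_suml; apply: ler_sum => s _.
rewrite -mulrBr normcM ler_wpM2l ?normc_ge0 // subrXX normcM mulrC.
rewrite ler_wpM2r ?normc_ge0 //; apply: (le_trans (normc_sum _ _ _)).
apply: (@le_trans _ _ (\sum_(i < s) 1)); last first.
  by rewrite sumr_const card_ord ler_nat ltnW.
apply: ler_sum => i _; rewrite normcM !normcX.
by rewrite -[leRHS]mulr1 ler_pM ?exprn_ge0 ?exprn_ile1 ?normc_ge0.
Qed.

End L1.

Section Symbol.
Variables (R : realType) (k : nat) (Qm : {poly R[i]}).
Implicit Type t : R[i].

(* With t = m / n in [0, 1], row m of shifted_mx is, up to O(1/n), the sequence
   of coefficients of the Laurent polynomial w - t^k Qm(w) / w^k; it is
   multiplied by w^k to get a polynomial. In [symbol], t is the inner variable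
   and w the outer one. *)
Definition symbol : {poly {poly R[i]}} :=
  'X^(k.+1) - polyC 'X^k * map_poly polyC Qm.

Definition symbol_at t : {poly R[i]} := 'X^(k.+1) - t ^+ k *: Qm.

Lemma coef_symbol_at p s t :
  (symbol_at t ^+ p)`_s = ((symbol ^+ p)`_s).[t].
Proof.
have -> : symbol_at t = map_poly (horner_eval t) symbol.
  have e : map_poly (horner_eval t) (map_poly polyC Qm) = Qm.
    by apply/polyP => i; rewrite !coef_map /= /horner_eval hornerC.
  rewrite /symbol rmorphB rmorphM /= map_polyXn map_polyC /= /horner_eval.
  rewrite hornerXn /symbol_at -mul_polyC; congr (_ - _ * _); exact: esym e.
by rewrite -rmorphXn coef_map.
Qed.

(** The coefficient of w^(k p) in [symbol ^+ p] is the constant term of the p-th power of the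
    Laurent polynomial; dividing its m-th coefficient by m + 1 integrates it over t in [0, 1]. *)
Definition limit_moment p : R[i] :=
  \sum_(m < size (symbol ^+ p)`_(k * p)) ((symbol ^+ p)`_(k * p))`_m / m.+1%:R.

Lemma symbol_power_bound p : exists2 K : R, 0 <= K &
  forall t s, normc t <= 1 -> normc (symbol_at t ^+ p)`_s <= K.
Proof.
exists (\sum_(s < size (symbol ^+ p)) coef_norm (symbol ^+ p)`_s).
  by rewrite sumr_ge0 // => s _; exact: coef_norm_ge0.
move=> t s t1; rewrite coef_symbol_at.
have [sl|sg] := ltnP s (size (symbol ^+ p)); last first.
  rewrite nth_default // horner0 normc0.
  by rewrite sumr_ge0 // => ? _; exact: coef_norm_ge0.
apply: (le_trans (normc_horner_le _ t1)).
rewrite (bigD1 (Ordinal sl)) //= lerDl.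
by rewrite sumr_ge0 // => ? _; exact: coef_norm_ge0.
Qed.

(** Allows t to be frozen in a matrix product: the rows that interact with row i have indices within
    k + 1 of i, hence parameters within (k + 1) / n of its own. *)
Lemma symbol_power_lip p : exists2 K : R, 0 <= K & forall t u s,
  normc t <= 1 -> normc u <= 1 ->
  normc ((symbol_at t ^+ p)`_s - (symbol_at u ^+ p)`_s) <= K * normc (t - u).
Proof.
pose c s : R := coef_norm (symbol ^+ p)`_s * (size (symbol ^+ p)`_s)%:R.
have c0 s : 0 <= c s by rewrite mulr_ge0 // coef_norm_ge0.
exists (\sum_(s < size (symbol ^+ p)) c s); first by rewrite sumr_ge0.
move=> t u s t1 u1; rewrite !coef_symbol_at.
have [sl|sg] := ltnP s (size (symbol ^+ p)); last first.
  rewrite nth_default // !horner0 subrr normc0 mulr_ge0 ?normc_ge0 //.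
  by rewrite sumr_ge0.
apply: (le_trans (normc_hornerB_le _ t1 u1)); rewrite ler_wpM2r ?normc_ge0 //.
by rewrite (bigD1 (Ordinal sl)) //= lerDl sumr_ge0.
Qed.

End Symbol.

Section ShiftedMatrix.
Variables (R : realType) (k : nat) (Q : nat -> {poly R[i]}) (Qm : {poly R[i]}).
Hypotheses (k0 : (0 < k)%N) (hQ : heun_operator k Q).
Hypothesis hQm : Q k = lead_coef (Q k) *: Qm.
Hypothesis Qmm : Qm \is monic.

Local Notation q := (lead_coef (Q k)).
Local Notation lam := (heun_lambda k Q).
Local Notation t n i := (i%:R / n%:R : R[i]).
Local Notation sym n i := (symbol_at k Qm (t n i)).

Lemma lead_coefQk : q = (Q k)`_k.+1.
Proof. by rewrite lead_coefE hQ.2. Qed.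

Lemma size_Qm : size Qm = k.+2.
Proof.
rewrite -hQ.2 hQm size_scale // lead_coefQk; exact: heun_lead_neq0.
Qed.

(** Reading the coefficient of X^i P at j + r avoids the exponent i - r, which is truncated when i <
    r; in that case i ^_ r = 0. *)
Lemma coef_mul_derivnXn (P : {poly R[i]}) i j r :
  (P * derivn r 'X^i)`_j = (i ^_ r)%:R * ('X^i * P)`_(j + r).
Proof.
rewrite derivnXn mulrnAr coefMn mulr_natl; have [ir|ri] := ltnP i r.
  by rewrite ffact_small.
congr (_ *+ _); rewrite coefMXn coefXnM.
have -> : (j < i - r)%N = (j + r < i)%N by rewrite ltn_subRL addnC.
case: ifP => // h; congr _`_ _; lia.
Qed.

(** The exact error has two sources: t^k in place of q i ^_ k / lambda_n, and the terms of d of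
    order r < k. *)
Lemma shifted_mx_symbol n (i j : 'I_n.+1) :
  shifted_mx k Q n i j - ('X^i * sym n i)`_(j + k) =
  (t n i ^+ k - q * (i ^_ k)%:R / lam n) * ('X^i * Qm)`_(j + k) -
  \sum_(1 <= r < k) (i ^_ r)%:R / lam n * ('X^i * Q r)`_(j + r).
Proof.
rewrite shifted_mxE /shifted_op coefB coefZ /diff_op coef_sum.
rewrite (eq_bigr (fun r => (i ^_ r)%:R * ('X^i * Q r)`_(j + r))); last first.
  by move=> r _; rewrite coef_mul_derivnXn.
have e : ('X^i * Q k)`_(j + k) = q * ('X^i * Qm)`_(j + k).
  by rewrite {1}hQm -scalerAr coefZ.
rewrite big_nat_recr //= e.
rewrite /symbol_at mulrBr coefB -scalerAr coefZ -exprD -exprS !coefXn.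
have -> : (j + k == i + k.+1)%N = (j == i.+1 :> nat) by lia.
rewrite mulrDr mulr_sumr.
rewrite (eq_bigr (fun r => (i ^_ r)%:R / lam n * ('X^i * Q r)`_(j + r))); last first.
  by move=> r _; rewrite mulrA [_^-1 * _]mulrC.
move: (\sum_(_ <= _ < _) _) => S; ring.
Qed.

(** lambda_n is q n^k up to O(n^(k-1)), and of exact order n^k, while i ^_ r <= n^(k-1) for r < k.
    The estimates are uniform in i; the influence of the lower coefficients is lost here. *)
Lemma falling_ratio_asymp : exists2 C : R, 0 <= C & exists N, forall n,
  (N <= n)%N -> (0 < n)%N /\ forall i, (i <= n)%N ->
    normc (t n i ^+ k - q * (i ^_ k)%:R / lam n) <= C / n%:R /\
    forall r, (r < k)%N -> normc ((i ^_ r)%:R / lam n) <= C / n%:R.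
Proof.
have q0 : 0 < normc q by rewrite normc_gt0 lead_coefQk heun_lead_neq0.
have [B B0 hB] := heun_lambda_asymp Q k0; have [N hN] := heun_lambda_ge k0 hQ.
rewrite -lead_coefQk in hB hN.
pose C1 := 2 * (B + normc q * (k ^ 2)%:R) / normc q; pose C2 := 2 / normc q.
have C10 : 0 <= C1 by rewrite divr_ge0 ?mulr_ge0 ?addr_ge0 ?mulr_ge0 ?normc_ge0.
have C20 : 0 <= C2 by rewrite divr_ge0 ?normc_ge0.
exists (C1 + C2); first exact: addr_ge0.
exists N.+1 => n nN; have n0 : (0 < n)%N by exact: leq_ltn_trans nN.
have nR : 0 < n%:R :> R by rewrite ltr0n.
have nC : (n%:R : R[i]) != 0 by rewrite pnatr_eq0 -lt0n.
split => // i i_n; have lge := hN n (ltnW nN).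
have l0 : 0 < normc (lam n).
  by apply: lt_le_trans lge; rewrite mulr_gt0 ?divr_gt0 ?exprn_gt0.
have lC : lam n != 0 by rewrite -normc_gt0.
set E : R := n%:R ^+ k.-1; have E0 : 0 < E by rewrite exprn_gt0.
have nk : n%:R ^+ k = n%:R * E :> R by rewrite -exprS prednK.
split=> [|r rk].
  apply: (@le_trans _ _ (C1 / n%:R)); last by rewrite ler_pM2r ?invr_gt0 // lerDl.
  have -> : t n i ^+ k - q * (i ^_ k)%:R / lam n =
    (i%:R ^+ k * (lam n - q * n%:R ^+ k) +
     q * n%:R ^+ k * (i%:R ^+ k - (i ^_ k)%:R)) / (n%:R ^+ k * lam n).
    rewrite expr_div_n; have nCk : (n%:R : R[i]) ^+ k != 0 by rewrite expf_neq0.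
    move: (i%:R ^+ k) (n%:R ^+ k) nCk => a b b0; field.
    by rewrite b0 lC.
  rewrite normcM normcV normcM normcX normc_nat ler_pdivrMr; last first.
    by rewrite mulr_gt0 ?exprn_gt0.
  apply: (@le_trans _ _ ((B + normc q * (k ^ 2)%:R) * (n%:R ^+ k * E))).
    apply: (le_trans (le_normcD _ _)); rewrite mulrDl; apply: lerD.
      rewrite normcM normcX normc_nat mulrCA.
      apply: ler_pM; rewrite ?exprn_ge0 ?normc_ge0 //.
      by rewrite lerXn2r ?nnegrE // ler_nat.
    rewrite !normcM normcX normc_nat -!mulrA ler_wpM2l ?normc_ge0 //.
    rewrite mulrCA ler_wpM2l ?exprn_ge0 //.
    rewrite -natrX -natrB ?ffact_le_expn // normc_nat /E -natrX -natrM ler_nat.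
    rewrite leq_subLR; apply: leq_trans (expn_le_ffact i k) _.
    rewrite leq_add2l leq_mul2l; apply/orP; right.
    by case: (k.-1) => // m; rewrite leq_exp2r.
  rewrite /C1.
  apply: le_trans (_ : _ <= 2 * (B + normc q * (k ^ 2)%:R) / normc q / n%:R *
     (n%:R ^+ k * (normc q / 2 * n%:R ^+ k))) _; last first.
    rewrite ler_wpM2l ?mulr_ge0 ?invr_ge0 ?addr_ge0 ?mulr_ge0 ?normc_ge0 //.
    by rewrite ler_wpM2l ?exprn_ge0.
  rewrite nk le_eqVlt; apply/orP; left; apply/eqP; field.
  by rewrite !gt_eqF.
apply: (@le_trans _ _ (C2 / n%:R)); last by rewrite ler_pM2r ?invr_gt0 // lerDr.
rewrite normcM normcV normc_nat ler_pdivrMr //.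
apply: (@le_trans _ _ E).
  rewrite /E -natrX ler_nat; apply: leq_trans (ffact_le_expn i r) _.
  apply: (@leq_trans (n ^ r)); first by case: r {rk} => // r; rewrite leq_exp2r.
  by rewrite leq_pexp2l //; clear -rk; lia.
apply: le_trans (_ : _ <= C2 / n%:R * (normc q / 2 * n%:R ^+ k)) _; last first.
  by rewrite ler_wpM2l // mulr_ge0 // invr_ge0.
rewrite nk /C2 le_eqVlt; apply/orP; left; apply/eqP; field.
by rewrite !gt_eqF.
Qed.

(** The sum of the errors over a row, rather than the largest one, is what combines in a matrix
    product with an entrywise bound on the other factor. *)
Lemma shifted_mx_row_err : exists2 C : R, 0 <= C & exists N, forall n,
  (N <= n)%N -> forall i : 'I_n.+1,
  \sum_(j < n.+1) normc (shifted_mx k Q n i j - ('X^i * sym n i)`_(j + k))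
    <= C / n%:R.
Proof.
have [C C0 [N hN]] := falling_ratio_asymp.
exists (C * (coef_norm Qm + \sum_(1 <= r < k) coef_norm (Q r))).
  rewrite mulr_ge0 // addr_ge0 ?coef_norm_ge0 // sumr_ge0 // => r _.
  exact: coef_norm_ge0.
exists N => n nN i; have [n0 /(_ i) []] := hN n nN; first by rewrite -ltnS.
move=> h1 h2; set e := C / n%:R in h1 h2 *.
have e0 : 0 <= e by rewrite divr_ge0.
apply: (@le_trans _ _ (\sum_(j < n.+1) (e * normc ('X^i * Qm)`_(j + k) +
    \sum_(1 <= r < k) e * normc ('X^i * Q r)`_(j + r)))).
  apply: ler_sum => j _; rewrite shifted_mx_symbol.
  apply: (le_trans (normcB _ _)); apply: lerD.
    by rewrite normcM ler_wpM2r ?normc_ge0.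
  apply: (le_trans (normc_sum _ _ _)); rewrite !big_nat; apply: ler_sum => r.
  by case/andP => _ rk; rewrite normcM ler_wpM2r ?normc_ge0 // h2.
rewrite big_split /= -mulr_sumr exchange_big /=.
have -> : C * (coef_norm Qm + \sum_(1 <= r < k) coef_norm (Q r)) / n%:R =
   e * coef_norm Qm + \sum_(1 <= r < k) e * coef_norm (Q r).
  by rewrite -mulr_sumr -mulrDr mulrAC.
apply: lerD; first by rewrite ler_wpM2l // sum_coef_shift_le.
by apply: ler_sum => r _; rewrite -mulr_sumr ler_wpM2l // sum_coef_shift_le.
Qed.

End ShiftedMatrix.

Lemma coefM_shift (A : comNzRingType) (P T : {poly A}) m M : (size P <= M)%N ->
  (P * T)`_m = \sum_(s < M) P`_s * ('X^s * T)`_m.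
Proof.
move=> PM; have {1}-> : P = \sum_(s < M) P`_s *: 'X^s.
  rewrite -poly_def; apply/polyP => s; rewrite coef_poly; case: ltnP => // Ms.
  by rewrite nth_default //; exact: leq_trans Ms.
rewrite mulr_suml coef_sum; apply: eq_bigr => s _.
by rewrite -scalerAl coefZ.
Qed.

Section MatrixPower.
Variables (R : realType) (k : nat) (Q : nat -> {poly R[i]}) (Qm : {poly R[i]}).
Hypotheses (k0 : (0 < k)%N) (hQ : heun_operator k Q).
Hypothesis hQm : Q k = lead_coef (Q k) *: Qm.
Hypothesis Qmm : Qm \is monic.

Local Notation t n i := (i%:R / n%:R : R[i]).
Local Notation sym n i := (symbol_at k Qm (t n i)).

Lemma normc_ratio_le1 (n i : nat) : (i <= n)%N -> normc (t n i) <= 1.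
Proof.
move=> i_n; have [->|n0] := posnP n; first by rewrite invr0 mulr0 normc0.
by rewrite normcM normcV !normc_nat ler_pdivrMr ?ltr0n // mul1r ler_nat.
Qed.

Lemma symbol_row_sum (n i r m : nat) : (i <= n)%N ->
  \sum_(l < m) normc ('X^i * sym n i)`_(l + r) <= 1 + coef_norm Qm.
Proof.
move=> i_n; have e : coef_norm ('X^(k.+1) : {poly R[i]}) = 1.
  rewrite -['X^(k.+1)]mulr1 coef_normXnM /coef_norm size_poly1 big_ord1.
  by rewrite coef1 eqxx normc1.
rewrite -{1}e; apply: le_trans (lerD (sum_coef_shift_le _ i r m) (sum_coef_shift_le _ i r m)).
rewrite -big_split /=; apply: ler_sum => l _.
rewrite /symbol_at mulrBr coefB -scalerAr coefZ.
apply: (le_trans (normcB _ _)); rewrite lerD2l normcM ler_piMl ?normc_ge0 //.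
by rewrite normcX exprn_ile1 ?normc_ge0 ?normc_ratio_le1.
Qed.

(** Column j corresponds to degree j + k, so degrees below k fall outside the matrix. They occur
    only in rows i < k, where t^k <= t = i / n <= k / n. *)
Lemma coef_XnM_symbol_boundary n i s : (i <= n)%N -> (s < k)%N ->
  normc ('X^i * sym n i)`_s <= k%:R * coef_norm Qm / n%:R.
Proof.
move=> i_n sk; rewrite coefXnM; case: ltnP => [_|is_].
  by rewrite normc0 !mulr_ge0 ?invr_ge0 ?coef_norm_ge0.
rewrite /symbol_at coefB coefXn coefZ.
have -> : (s - i == k.+1)%N = false by lia.
rewrite sub0r normcN normcM mulrAC; apply: ler_pM;
  rewrite ?normc_ge0 //; last exact: normc_coef_le.
rewrite normcX; apply: (@le_trans _ _ (normc (t n i))).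
  by rewrite -[leRHS]expr1 ler_wiXn2l ?normc_ge0 ?normc_ratio_le1.
by rewrite normcM normcV !normc_nat ler_wpM2r ?invr_ge0 // ler_nat; lia.
Qed.

(** The other edge: degree k + n + 1 is reached only from row n, where t = 1 and the leading terms
    of X^(k+1) and [Qm] cancel. *)
Lemma coef_XnM_symbol_last (n i : nat) : (0 < n)%N -> (i <= n)%N ->
  ('X^i * sym n i)`_(k + n.+1) = 0.
Proof.
move=> n0 i_n; rewrite coefXnM ifF; last by lia.
rewrite /symbol_at coefB coefXn coefZ; have sQ := size_Qm hQ hQm.
have [->|ni] := eqVneq i n.
  have -> : (k + n.+1 - n)%N = k.+1 by lia.
  rewrite eqxx divff ?pnatr_eq0 -?lt0n // expr1n mul1r.
  have := monicP Qmm; rewrite lead_coefE sQ /= => ->; exact: subrr.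
have -> : (k + n.+1 - i == k.+1)%N = false by lia.
by rewrite nth_default ?mulr0 ?subrr // sQ; lia.
Qed.

(** With t frozen, the sum over l would be a full product of polynomials if no degree were cut off.
    The k degrees cut off below contribute O(1/n), the single one above contributes 0. *)
Lemma symbol_conv n (i j : 'I_n.+1) p (K : R) : (0 < n)%N -> 0 <= K ->
  (forall s, normc (sym n i ^+ p)`_s <= K) ->
  normc (\sum_(l < n.+1) ('X^i * sym n i)`_(l + k) *
           ('X^l * sym n i ^+ p)`_(j + k * p) -
         ('X^i * sym n i ^+ p.+1)`_(j + k * p.+1))
    <= k%:R * (k%:R * coef_norm Qm) * K / n%:R.
Proof.
move=> n0 K0 hK; have i_n : (i <= n)%N by rewrite -ltnS.
have sQ := size_Qm hQ hQm.
have hs : (size ('X^i * sym n i)%R <= k + n.+2)%N.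
  apply: leq_trans (size_polyMleq _ _) _; rewrite size_polyXn.
  apply: (@leq_trans (i + k.+2)); last by lia.
  rewrite addSn /= leq_add2l /symbol_at.
  apply: leq_trans (size_polyD _ _) _; rewrite geq_max size_polyXn leqnn size_polyN.
  by apply: leq_trans (size_scale_leq _ _) _; rewrite sQ.
rewrite exprS mulrA (coefM_shift _ _ hs) big_split_ord /=.
rewrite [X in _ - (_ + X)]big_ord_recr /=.
rewrite coef_XnM_symbol_last // mul0r addr0.
have -> : \sum_(l < n.+1) ('X^i * sym n i)`_(k + l) *
    ('X^(k + l) * sym n i ^+ p)`_(j + k * p.+1) =
  \sum_(l < n.+1) ('X^i * sym n i)`_(l + k) * ('X^l * sym n i ^+ p)`_(j + k * p).
  apply: eq_bigr => l _; congr (_ * _); first by rewrite addnC.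
  by rewrite exprD -mulrA coefXnM mulnS addnCA ltnNge leq_addr /= addKn.
rewrite opprD addrCA subrr addr0 normcN.
apply: (le_trans (normc_sum _ _ _)).
apply: (@le_trans _ _ (\sum_(s < k) (k%:R * coef_norm Qm / n%:R * K))).
  apply: ler_sum => s _; rewrite normcM; apply: ler_pM; rewrite ?normc_ge0 //.
    exact: coef_XnM_symbol_boundary.
  by rewrite coefXnM; case: ltnP => // _; rewrite normc0.
rewrite sumr_const card_ord -mulr_natl le_eqVlt; apply/orP; left; apply/eqP.
by ring.
Qed.

Lemma shifted_mx_pow_err p : exists2 C : R, 0 <= C & exists N, forall n,
  (N <= n)%N -> forall i j : 'I_n.+1,
  normc ((shifted_mx k Q n ^+ p) i j - ('X^i * sym n i ^+ p)`_(j + k * p))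
    <= C / n%:R.
Proof.
elim: p => [|p [C C0 [N hN]]].
  exists 0 => //; exists 0%N => n _ i j.
  by rewrite !expr0 mulr1 muln0 addn0 coefXn mxE eq_sym subrr normc0 mul0r.
have [C1 C10 [N1 hN1]] := shifted_mx_row_err k0 hQ hQm Qmm.
have [K K0 hK] := symbol_power_bound k Qm p.
have [L L0 hL] := symbol_power_lip k Qm p.
set M := 1 + coef_norm Qm.
have M0 : 0 <= M by rewrite addr_ge0 ?coef_norm_ge0.
exists ((M + C1) * C + C1 * K + M * (L * k.+1%:R) +
        k%:R * (k%:R * coef_norm Qm) * K).
  by rewrite !(addr_ge0, mulr_ge0) ?coef_norm_ge0.
exists (N + N1).+1 => n nN i j.
have n0 : (0 < n)%N by exact: leq_ltn_trans nN.
have nR : 0 < n%:R :> R by rewrite ltr0n.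
have i_n : (i <= n)%N by rewrite -ltnS.
have row := hN1 n (leq_trans (leq_addl N N1) (ltnW nN)) i.
have {}hN := hN n (leq_trans (leq_addr N1 N) (ltnW nN)).
pose A := shifted_mx k Q n.
pose S l := ('X^i * sym n i)`_(l + k) : R[i].
pose T (l j : nat) := ('X^l * sym n l ^+ p)`_(j + k * p) : R[i].
pose U (l j : nat) := ('X^l * sym n i ^+ p)`_(j + k * p) : R[i].
have SM : \sum_(l < n.+1) normc (S l) <= M by exact: symbol_row_sum.
have AM : \sum_(l < n.+1) normc (A i l) <= M + C1.
  apply: (@le_trans _ _ (\sum_(l < n.+1) (normc (S l) + normc (A i l - S l)))).
    apply: ler_sum => l _; apply: le_trans (le_normcD _ _); rewrite addrC subrK //.
  rewrite big_split lerD //; apply: le_trans row _.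
  by rewrite ler_pdivrMr // ler_peMr // ler1n.
(* Four successive replacements: the power [A ^+ p] by its approximation [T], row i of [A] by its
   symbol [S], the parameter of row l by that of row i (from [T] to [U]), and the truncated sum by
   the full product. *)
have -> : (A ^+ p.+1) i j - ('X^i * sym n i ^+ p.+1)`_(j + k * p.+1) =
   \sum_(l < n.+1) A i l * ((A ^+ p) l j - T l j) +
   \sum_(l < n.+1) (A i l - S l) * T l j +
   \sum_(l < n.+1) S l * (T l j - U l j) +
   (\sum_(l < n.+1) S l * U l j - ('X^i * sym n i ^+ p.+1)`_(j + k * p.+1)).
  rewrite exprS mxE addrA -!big_split /=; congr (_ - _).
  by apply: eq_bigr => l _; ring.
rewrite [leRHS]mulrDl [X in _ <= X + _]mulrDl [X in _ <= X + _ + _]mulrDl.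
have tri (a b c d : R[i]) (x y z w : R) : normc a <= x -> normc b <= y ->
    normc c <= z -> normc d <= w -> normc (a + b + c + d) <= x + y + z + w.
  move=> ax bx cx dx; apply: le_trans (le_normcD _ _) (lerD _ dx).
  apply: le_trans (le_normcD _ _) (lerD _ cx).
  exact: le_trans (le_normcD _ _) (lerD _ _).
apply: tri.
- apply: (le_trans (normc_sum _ _ _)).
  apply: (@le_trans _ _ (\sum_l normc (A i l) * (C / n%:R))).
    by apply: ler_sum => l _; rewrite normcM ler_wpM2l ?normc_ge0 ?hN.
  by rewrite -mulr_suml -mulrA ler_wpM2r ?divr_ge0.
- apply: (le_trans (normc_sum _ _ _)).
  apply: (@le_trans _ _ (\sum_(l < n.+1) normc (A i l - S l) * K)).
    apply: ler_sum => l _; rewrite normcM ler_wpM2l ?normc_ge0 //.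
    rewrite /T coefXnM; case: ltnP => _; first by rewrite normc0.
    by apply: hK; apply: normc_ratio_le1; rewrite -ltnS.
  by rewrite -mulr_suml mulrAC ler_wpM2r.
- apply: (le_trans (normc_sum _ _ _)).
  apply: (@le_trans _ _ (\sum_(l < n.+1) normc (S l) * (L * k.+1%:R / n%:R))).
    apply: ler_sum => l _; rewrite normcM.
    have [->|Sl] := eqVneq (S l) 0; first by rewrite normc0 !mul0r.
    rewrite ler_wpM2l ?normc_ge0 //.
    have l_n : (l <= n)%N by rewrite -ltnS.
    apply: (@le_trans _ _ (L * normc (t n l - t n i))).
      rewrite /T /U !coefXnM; case: ltnP => _.
        by rewrite subrr normc0 mulr_ge0 ?normc_ge0.
      by apply: hL; exact: normc_ratio_le1.
    rewrite -mulrA ler_wpM2l // -mulrBl normcM normcV normc_nat.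
    rewrite ler_wpM2r ?invr_ge0 //.
    (* The symbol is banded: [S l] is nonzero only if i <= l + k <= i + k + 1. *)
    have : (l + k < i + k.+2)%N.
      rewrite ltnNge; apply: contra Sl => h; apply/eqP.
      rewrite /S coefXnM; case: ltnP => // _; rewrite nth_default //.
      apply: (@leq_trans k.+2); last by clear -h; lia.
      apply: leq_trans (size_polyD _ _) _.
      rewrite geq_max size_polyXn leqnn size_polyN.
      apply: leq_trans (size_scale_leq _ _) _.
      by rewrite (size_Qm hQ hQm).
    have : (i <= l + k)%N.
      rewrite leqNgt; apply: contra Sl => h; apply/eqP.
      by rewrite /S coefXnM h.
    move=> h1 h2; have [il|li] := leqP i l.
      rewrite -natrB // normc_nat ler_nat; clear -il h2; lia.
    by rewrite normc_distC -natrB ?(ltnW li) // normc_nat ler_nat; clear -li h1; lia.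
  by rewrite -mulr_suml -[leRHS]mulrA ler_wpM2r // mulr_ge0 ?invr_ge0 ?mulr_ge0.
- apply: symbol_conv => // s; apply: hK; exact: normc_ratio_le1.
Qed.

End MatrixPower.

(** * Power sums as Riemann sums *)

Section PowerSums.

(** The hockey-stick identity. Falling factorials sum exactly, and they differ from powers by a
    lower order. *)
Lemma sum_ffact m n : (m.+1 * \sum_(i < n.+1) i ^_ m = n.+1 * n ^_ m)%N.
Proof.
rewrite -ffactSS; elim: n => [|n IH].
  by rewrite big_ord_recl big_ord0 addn0 ffactSS; case: m => // m; rewrite muln0.
rewrite big_ord_recr /= mulnDr IH ffactnSr ffactSS.
have [mn|nm] := leqP m n.+1; last by rewrite ffact_small // !muln0.
rewrite [(m.+1 * _)%N]mulnC -mulnDr mulnC; congr (_ * _)%N; lia.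
Qed.

Lemma sum_expn_ge m n :
  (n.+1 * n ^ m <= m.+1 * (\sum_(i < n.+1) i ^ m) +
                   m.+1 * (n.+1 * (m ^ 2 * n ^ m.-1)))%N.
Proof.
apply: (@leq_trans (n.+1 * n ^_ m + n.+1 * (m ^ 2 * n ^ m.-1))).
  by rewrite -mulnDr leq_mul2l expn_le_ffact orbT.
apply: leq_add; last by rewrite leq_pmull.
by rewrite -sum_ffact leq_mul2l leq_sum // => i _; exact: ffact_le_expn.
Qed.

Lemma sum_expn_le m n :
  (m.+1 * (\sum_(i < n.+1) i ^ m) <= n.+1 * n ^ m +
                   m.+1 * (n.+1 * (m ^ 2 * n ^ m.-1)))%N.
Proof.
apply: (@leq_trans (m.+1 * (\sum_(i < n.+1) i ^_ m) +
    m.+1 * (n.+1 * (m ^ 2 * n ^ m.-1)))); last first.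
  by rewrite leq_add2r sum_ffact leq_mul2l ffact_le_expn orbT.
rewrite -mulnDr leq_mul2l /=.
have -> : (n.+1 * (m ^ 2 * n ^ m.-1) = \sum_(i < n.+1) m ^ 2 * n ^ m.-1)%N.
  by rewrite sum_nat_const card_ord.
rewrite -big_split leq_sum //= => i _; apply: leq_trans (expn_le_ffact i m) _.
rewrite leq_add2l leq_mul2l; apply/orP; right.
by case: (m.-1) => // r; rewrite leq_exp2r // -ltnS.
Qed.

Lemma normc_natB (R : realType) (a b c : nat) : (a <= b + c)%N -> (b <= a + c)%N ->
  normc (a%:R - b%:R : R[i]) <= c%:R.
Proof.
move=> abc bac; have [ab|ba] := leqP a b.
  by rewrite normc_distC -natrB // normc_nat ler_nat; lia.
by rewrite -natrB ?(ltnW ba) // normc_nat ler_nat; lia.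
Qed.

Lemma power_sum_mean (R : realType) m n : (0 < n)%N ->
  normc (n.+1%:R^-1 * \sum_(i < n.+1) (i%:R / n%:R) ^+ m - m.+1%:R^-1 : R[i])
    <= (m ^ 2)%:R / n%:R.
Proof.
move=> n0; have nC : (n%:R : R[i]) != 0 by rewrite pnatr_eq0 -lt0n.
have mC j : (j.+1%:R : R[i]) != 0 by rewrite pnatr_eq0.
have -> : n.+1%:R^-1 * \sum_(i < n.+1) (i%:R / n%:R) ^+ m - m.+1%:R^-1 =
    ((m.+1 * (\sum_(i < n.+1) i ^ m))%:R - (n.+1 * n ^ m)%:R) /
      (m.+1%:R * n.+1%:R * n%:R ^+ m) :> R[i].
  rewrite (eq_bigr (fun i : 'I_n.+1 => i%:R ^+ m / n%:R ^+ m)); last first.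
    by move=> i _; rewrite expr_div_n.
  rewrite -mulr_suml !natrM natr_sum.
  rewrite [in RHS](eq_bigr (fun i : 'I_n.+1 => i%:R ^+ m)); last first.
    by move=> i _; rewrite natrX.
  rewrite natrX; move: (\sum_(i < n.+1) _) => S.
  have := expf_neq0 m nC; move: (n%:R ^+ m) => N N0.
  have := mC n; have := mC m; move: (n.+1%:R) (m.+1%:R) => a b b0 a0.
  by field; rewrite N0 b0 a0.
have nR : 0 < n%:R :> R by rewrite ltr0n.
rewrite normcM normcV !normcM normcX !normc_nat ler_pdivrMr; last first.
  by rewrite !mulr_gt0 ?exprn_gt0.
apply: (le_trans (normc_natB _ (sum_expn_le m n) (sum_expn_ge m n))).
case: m => [|m]; first by rewrite !mul0n !muln0 !mulr_ge0 // invr_ge0.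
rewrite !natrM natrX /= exprS le_eqVlt; apply/orP; left; apply/eqP.
by field; rewrite gt_eqF.
Qed.

End PowerSums.

Section TraceLimit.
Variables (R : realType) (k : nat) (Q : nat -> {poly R[i]}) (Qm : {poly R[i]}).
Hypotheses (k0 : (0 < k)%N) (hQ : heun_operator k Q).
Hypothesis hQm : Q k = lead_coef (Q k) *: Qm.
Hypothesis Qmm : Qm \is monic.

(** On the diagonal the shift by i cancels: entry (i, i) of the p-th power is phi(i / n) + O(1/n)
    for the polynomial phi whose integral is [limit_moment], so the normalized trace is nearly a
    Riemann sum. *)
Lemma trace_limit p : exists2 C : R, 0 <= C & exists N, forall n, (N <= n)%N ->
  normc (n.+1%:R^-1 * \tr (shifted_mx k Q n ^+ p) - limit_moment k Qm p)
    <= C / n%:R.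
Proof.
have [C C0 [N hN]] := shifted_mx_pow_err k0 hQ hQm Qmm p.
pose phi := (symbol k Qm ^+ p)`_(k * p).
exists (C + \sum_(m < size phi) normc phi`_m * (m ^ 2)%:R).
  by rewrite addr_ge0 // sumr_ge0 // => m _; rewrite mulr_ge0 ?normc_ge0.
exists N.+1 => n nN; have n0 : (0 < n)%N by exact: leq_ltn_trans nN.
have {}hN := hN n (ltnW nN).
have e1 : n.+1%:R^-1 * \sum_(i < n.+1) phi.[i%:R / n%:R] - limit_moment k Qm p =
    \sum_(m < size phi) phi`_m *
      (n.+1%:R^-1 * (\sum_(i < n.+1) (i%:R / n%:R) ^+ m) - m.+1%:R^-1).
  rewrite /limit_moment -/phi.
  rewrite [in RHS](eq_bigr (fun m : 'I_(size phi) => n.+1%:R^-1 *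
    (\sum_(i < n.+1) phi`_m * (i%:R / n%:R) ^+ m) - phi`_m / m.+1%:R)); last first.
    by move=> m _; rewrite mulrBr mulrCA -mulr_sumr.
  rewrite sumrB -mulr_sumr exchange_big /=; congr (_ * _ - _).
  by apply: eq_bigr => i _; rewrite horner_coef.
have -> : n.+1%:R^-1 * \tr (shifted_mx k Q n ^+ p) - limit_moment k Qm p =
  n.+1%:R^-1 * \sum_(i < n.+1) ((shifted_mx k Q n ^+ p) i i - phi.[i%:R / n%:R]) +
  \sum_(m < size phi) phi`_m *
      (n.+1%:R^-1 * (\sum_(i < n.+1) (i%:R / n%:R) ^+ m) - m.+1%:R^-1).
  by rewrite -e1 sumrB mulrBr addrA subrK.
rewrite mulrDl; apply: (le_trans (le_normcD _ _)); apply: lerD.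
  rewrite normcM normcV normc_nat mulrC ler_pdivrMr ?ltr0n //.
  apply: (le_trans (normc_sum _ _ _)).
  apply: (@le_trans _ _ (\sum_(i < n.+1) C / n%:R)); last first.
    by rewrite sumr_const card_ord mulr_natr.
  apply: ler_sum => i _; have := hN i i.
  by rewrite coefXnM ltnNge leq_addr /= addKn coef_symbol_at.
apply: (le_trans (normc_sum _ _ _)); rewrite mulr_suml; apply: ler_sum => m _.
by rewrite normcM -mulrA ler_wpM2l ?normc_ge0 // power_sum_mean.
Qed.

End TraceLimit.

(** * The first two limit moments *)

Section FirstMoments.
Variable R : realType.
Implicit Types s : seq R[i].

Lemma coef_size_prod_XsubC s : (\prod_(x <- s) ('X - x%:P))`_(size s) = 1.
Proof.
have /monicP := monic_prod_XsubC s xpredT id.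
by rewrite lead_coefE size_prod_XsubC.
Qed.

(** Vieta's formula for the subleading coefficient. The factor X, and X^2 in the next lemma, shift
    the index so that short lists follow the same formula. *)
Lemma coef1_prod_XsubC s :
  ('X * \prod_(x <- s) ('X - x%:P))`_(size s) = - \sum_(x <- s) x.
Proof.
elim: s => [|x s IH]; first by rewrite !big_nil oppr0 mulr1 coefX.
rewrite !big_cons coefXM /= mulrBl coefB IH coefCM coef_size_prod_XsubC mulr1.
by rewrite opprD addrC.
Qed.

Lemma coef2_prod_XsubC s :
  ('X^2 * \prod_(x <- s) ('X - x%:P))`_(size s) *+ 2 =
  (\sum_(x <- s) x) ^+ 2 - \sum_(x <- s) x ^+ 2.
Proof.
elim: s => [|x s IH].
  by rewrite !big_nil mulr1 coefXn mul0rn expr0n subr0.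
rewrite !big_cons mulrCA mulrBl coefB coefXM /= coefCM mulrnBl IH.
by rewrite exprS -mulrA coefXM /= expr1 coef1_prod_XsubC; ring.
Qed.

Lemma integral_two_powers (a b : R[i]) p q :
  let P := a *: 'X^p + b *: 'X^q in
  \sum_(m < size P) P`_m / m.+1%:R = a / p.+1%:R + b / q.+1%:R.
Proof.
move=> P; pose M := (p + q).+1.
have sP : (size P <= M)%N.
  apply: leq_trans (size_polyD _ _) _; rewrite geq_max.
  by apply/andP; split; apply: leq_trans (size_scale_leq _ _) _;
    rewrite size_polyXn ltnS ?leq_addr ?leq_addl.
rewrite (big_ord_widen _ (fun m => P`_m / m.+1%:R) sP) big_mkcond /=.
rewrite (eq_bigr (fun m : 'I_M => (if m == p :> nat then a / m.+1%:R else 0) +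
                          (if m == q :> nat then b / m.+1%:R else 0))).
  rewrite big_split /=; congr (_ + _); rewrite -big_mkcond /=.
    by rewrite (big_ord1_eq _ (fun m => a / m.+1%:R)) ltnS leq_addr.
  by rewrite (big_ord1_eq _ (fun m => b / m.+1%:R)) ltnS leq_addl.
move=> m _; have -> : (if (m < size P)%N then P`_m / m.+1%:R else 0) =
    P`_m / m.+1%:R.
  by case: ltnP => // h; rewrite nth_default // mul0r.
rewrite /P coefD !coefZ !coefXn mulrDl.
by do 2 case: (_ == _); rewrite ?mulr1 ?mulr0 ?mul0r.
Qed.

(** The coefficient of w^k in the symbol is t^k times the sum of the zeros, and t^k integrates to 1
    / (k + 1). *)
Lemma limit_moment1 k (xi : 'I_k.+1 -> R[i]) :
  limit_moment k (\prod_j ('X - (xi j)%:P)) 1 = (\sum_j xi j) / k.+1%:R.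
Proof.
rewrite /limit_moment; set Qm := \prod_j _.
pose s := [seq xi j | j <- enum 'I_k.+1].
have ss : size s = k.+1 by rewrite size_map size_enum_ord.
have Qms : Qm = \prod_(x <- s) ('X - x%:P) by rewrite /s big_map big_enum.
have Qk : Qm`_k = - \sum_j xi j.
  by have := coef1_prod_XsubC s; rewrite -Qms ss coefXM /= /s big_map big_enum.
have -> : (symbol k Qm ^+ 1)`_(k * 1) = (\sum_j xi j) *: 'X^k + 0 *: 'X^0.
  rewrite expr1 muln1 /symbol coefB coefXn ltn_eqF // coefCM coef_map /= Qk.
  by rewrite sub0r polyCN mulrN opprK mulrC mul_polyC scale0r addr0.
by rewrite integral_two_powers mul0r addr0.
Qed.

(** Let 2 e_2 = p1^2 - p2. In the square of the symbol, the coefficient of w^(2 k) receives nothing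
    from w^(2 k + 2), - 2 e_2 t^k from the cross term and (p1^2 + 2 e_2) t^(2 k) from the square of
    [Qm]. *)
Lemma limit_moment2 k (xi : 'I_k.+1 -> R[i]) : (0 < k)%N ->
  let p1 := \sum_j xi j in let p2 := \sum_j xi j ^+ 2 in
  limit_moment k (\prod_j ('X - (xi j)%:P)) 2 =
    (p1 ^+ 2 *+ 2 - p2) / (2 * k).+1%:R - (p1 ^+ 2 - p2) / k.+1%:R.
Proof.
move=> k0 p1 p2; rewrite /limit_moment; set Qm := \prod_j _.
pose s := [seq xi j | j <- enum 'I_k.+1].
have ss : size s = k.+1 by rewrite size_map size_enum_ord.
have Qms : Qm = \prod_(x <- s) ('X - x%:P) by rewrite /s big_map big_enum.
have two0 : (2%:R : R[i]) != 0 by rewrite pnatr_eq0.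
have s1 : \sum_(x <- s) x = p1 by rewrite /s big_map big_enum.
have s2 : \sum_(x <- s) x ^+ 2 = p2 by rewrite /s big_map big_enum.
have Qk : Qm`_k.-1 *+ 2 = p1 ^+ 2 - p2.
  have := coef2_prod_XsubC s; rewrite -Qms ss s1 s2 coefXnM => <-.
  by rewrite ifF; [congr (_`_ _ *+ 2); lia | lia].
(* The two top coefficients of Qm ^ 2 come from its list of roots s ++ s. *)
have Q2k : (Qm ^+ 2)`_(2 * k) = p1 ^+ 2 *+ 2 - p2.
  have := coef2_prod_XsubC (s ++ s).
  rewrite !big_cat /= -Qms -expr2 size_cat ss s1 s2 coefXnM /=.
  rewrite ifF; last by lia.
  have -> : (k.+1 + k.+1 - 2 = 2 * k)%N by lia.
  rewrite -[_ *+ 2]mulr_natr => e; apply: (mulIf two0); rewrite e; ring.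
have -> : (symbol k Qm ^+ 2)`_(k * 2) =
    (p1 ^+ 2 *+ 2 - p2) *: 'X^(2 * k) + (- (p1 ^+ 2 - p2)) *: 'X^k.
  have -> : symbol k Qm ^+ 2 = 'X^(k.+1 + k.+1) -
     polyC 'X^k * ('X^(k.+1) * map_poly polyC Qm) *+ 2 +
     polyC ('X^(2 * k)) * map_poly polyC (Qm ^+ 2).
    rewrite /symbol sqrrB exprMn; congr (_ - _ *+ 2 + _ * _).
    - by rewrite expr2 -exprD.
    - exact: mulrCA.
    - by rewrite mulnC exprM [RHS]polyC_exp.
    - by rewrite rmorphXn.
  have e1 : ('X^(k.+1) * map_poly polyC Qm)`_(2 * k) = (Qm`_k.-1)%:P.
    rewrite coefXnM ifF; last by lia.
    by rewrite coef_map /=; congr (_`_ _)%:P; lia.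
  rewrite (mulnC k 2) coefD coefB coefMn coefXn !coefCM e1 coef_map /= Q2k.
  rewrite ltn_eqF; last by lia.
  rewrite ['X^k * _]mulrC mul_polyC scalerMnl Qk sub0r addrC mulrC mul_polyC.
  by rewrite scaleNr.
by rewrite integral_two_powers mulNr.
Qed.

End FirstMoments.

(** More than uniform continuity on A, since x + d may leave A: it will compare a root off the
    segment with its projection. *)
Lemma compact_unif_near (K : numFieldType) (V : normedModType K) (R : realType)
    (f : V -> R) (A : set V) (e : R) :
  continuous f -> compact A -> 0 < e ->
  \forall d \near (0 : V), forall x, A x -> `|f (x + d) - f x| < e.
Proof.
move=> cf /compact_near_coveringP cA e0.
have := cA V (nbhs (0 : V)) (fun d x => `|f (x + d) - f x| < e) _.
apply => x Ax.
have : (fun p : V * V => f (p.1 + p.2) - f p.1) @ (x, 0 : V) --> (f (x + 0) - f x : R).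
  apply: cvgB.
    apply: continuous_cvg; first exact: cf.
    apply: cvgD; [exact: cvg_fst | exact: cvg_snd].
  apply: continuous_cvg; [exact: cf | exact: cvg_fst].
rewrite addr0 subrr => /cvgr0Pnorm_lt /(_ e e0).
by [].
Qed.

(** * Weierstrass approximation *)

Section Bernstein.
Variable R : realType.
Implicit Types (x : R) (g h : nat -> R).

(* The mean of g over a binomial (n, x) variable. *)
Fixpoint bernstein n x g : R :=
  if n is m.+1 then bernstein m x (fun j => x * g j.+1 + (1 - x) * g j)
  else g 0%N.

Lemma bernstein_le n x g h : 0 <= x <= 1 ->
  (forall j, (j <= n)%N -> g j <= h j) -> bernstein n x g <= bernstein n x h.
Proof.
move=> /andP[x0 x1]; elim: n g h => [|n IH] g h gh /=; first exact: gh.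
apply: IH => j jn; apply: lerD; apply: ler_wpM2l; rewrite ?subr_ge0 //.
  by apply: gh.
by apply: gh; exact: leqW.
Qed.

Lemma eq_bernstein n x g h : (forall j, (j <= n)%N -> g j = h j) ->
  bernstein n x g = bernstein n x h.
Proof.
elim: n g h => [|n IH] g h gh /=; first exact: gh.
by apply: IH => j jn; rewrite !gh // leqW.
Qed.

Lemma bernsteinD n x g h (a b : R) :
  bernstein n x (fun j => a * g j + b * h j) =
  a * bernstein n x g + b * bernstein n x h.
Proof.
elim: n g h => [//|n IH] g h /=; rewrite -IH; apply: eq_bernstein => j _; ring.
Qed.

Lemma bernstein_cst n x (a : R) : bernstein n x (fun=> a) = a.
Proof.
elim: n => [//|n IH] /=; rewrite -[RHS]IH; apply: eq_bernstein => j _; ring.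
Qed.

Lemma bernstein_variance n x :
  bernstein n x (fun j => (j%:R - n%:R * x) ^+ 2) = n%:R * (x * (1 - x)).
Proof.
elim: n => [|n IH] /=; first by rewrite !mul0r subr0 expr0n.
transitivity (bernstein n x (fun j => 1 * (j%:R - n%:R * x) ^+ 2 +
                                      (x * (1 - x)) * 1)).
  by apply: eq_bernstein => j _; rewrite -[j.+1%:R]natr1 -[n.+1%:R]natr1; ring.
by rewrite bernsteinD bernstein_cst IH -[n.+1%:R]natr1; ring.
Qed.

Lemma bernstein_poly n (g : nat -> R) :
  exists P : {poly R}, forall x, P.[x] = bernstein n x g.
Proof.
have gen (G : nat -> {poly R}) : exists P : {poly R}, forall x,
    P.[x] = bernstein n x (fun j => (G j).[x]).
  elim: n G => [|n IH] G /=; first by exists (G 0%N).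
  have [P hP] := IH (fun j => 'X * G j.+1 + (1 - 'X) * G j).
  exists P => x; rewrite hP; apply: eq_bernstein => j _.
  by rewrite !hornerE.
have [P hP] := gen (fun j => (g j)%:P).
by exists P => x; rewrite hP; apply: eq_bernstein => j _; rewrite hornerC.
Qed.

(** For y in [0, 1], |f y - f x| <= e / 2 + 2 M ((y - x) / d)^2: either y is within d of x, or the
    last term is at least 2 M. Averaging over the binomial law turns the square of y - x into the
    variance x (1 - x) / n. *)
Lemma bernstein_approx (f : R -> R) (e : R) : continuous f -> 0 < e ->
  exists P : {poly R}, forall x, 0 <= x <= 1 -> `|f x - P.[x]| <= e.
Proof.
move=> cf e0; have cK : compact `[0 : R, 1]%classic by exact: segment_compact.
have e20 : 0 < e / 2 by rewrite divr_gt0.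
have := compact_unif_near (V := R^o) cf cK e20.
move=> /nbhs_ballP[d /= d0 hd].
have {}hd x y : 0 <= x <= 1 -> `|y - x| < d -> `|f y - f x| < e / 2.
  move=> x01 yx; have := hd (y - x); rewrite /ball /= sub0r normrN => /(_ yx x).
  have -> : x + (y - x) = y by rewrite addrC subrK.
  by apply; rewrite /= in_itv.
have [M hM] : exists M : R, forall x, 0 <= x <= 1 -> `|f x| <= M.
  have [] := compact_bounded (continuous_compact (continuous_subspaceT cf) cK).
  move=> M [_ /(_ (M + 1))]; rewrite ltrDl ltr01 => /(_ isT) h.
  by exists (M + 1) => x x01; apply: h; exists x => //=; rewrite in_itv.
have M0 : 0 <= M by apply: le_trans (hM 0 _); rewrite // lexx ler01.
(* Large enough for 2 M / (n d^2) <= e / 2. *)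
pose n := (Num.bound (4 * M / (d ^+ 2 * e))).+1.
have n0 : 0 < n%:R :> R by rewrite ltr0n.
have [P hP] := bernstein_poly n (fun j => f (j%:R / n%:R)).
exists P => x /[dup] x01 /andP[x0 x1]; rewrite hP.
have Mn : 2 * M / (n%:R * d) ^+ 2 * (n%:R * (x * (1 - x))) <= e / 2.
  have hn : 4 * M / (d ^+ 2 * e) <= n%:R.
    apply: ltW; apply: lt_le_trans (archi_boundP _) _.
      by rewrite divr_ge0 // mulr_ge0 ?exprn_ge0 ?(ltW d0) ?(ltW e0).
    by rewrite ler_nat.
  have xx : x * (1 - x) <= 1 by nra.
  have xx0 : 0 <= x * (1 - x) by rewrite mulr_ge0 // subr_ge0.
  have -> : 2 * M / (n%:R * d) ^+ 2 * (n%:R * (x * (1 - x))) =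
      2 * M / d ^+ 2 / n%:R * (x * (1 - x)).
    by field; rewrite !gt_eqF.
  apply: (@le_trans _ _ (2 * M / d ^+ 2 / n%:R)).
    by rewrite ler_piMr ?divr_ge0 ?mulr_ge0 ?exprn_ge0 // ltW.
  rewrite ler_pdivrMr //; move: hn; rewrite ler_pdivrMr ?mulr_gt0 ?exprn_gt0 //.
  rewrite ler_pdivrMr ?exprn_gt0 //; lra.
have bound g : (forall j, (j <= n)%N -> g j <= e / 2 * 1 +
     2 * M / (n%:R * d) ^+ 2 * (j%:R - n%:R * x) ^+ 2) -> bernstein n x g <= e.
  move=> hg; apply: (le_trans (bernstein_le x01 hg)).
  by rewrite bernsteinD bernstein_cst bernstein_variance mulr1; lra.
have close j : (j <= n)%N -> `|f (j%:R / n%:R) - f x| <= e / 2 * 1 +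
     2 * M / (n%:R * d) ^+ 2 * (j%:R - n%:R * x) ^+ 2.
  move=> jn; set y := j%:R / n%:R.
  have y01 : 0 <= y <= 1 by rewrite divr_ge0 //= ler_pdivrMr // mul1r ler_nat.
  have -> : 2 * M / (n%:R * d) ^+ 2 * (j%:R - n%:R * x) ^+ 2 =
      2 * M * ((y - x) / d) ^+ 2.
    by rewrite /y; field; rewrite !gt_eqF.
  have sq0 : 0 <= 2 * M * ((y - x) / d) ^+ 2.
    by rewrite mulr_ge0 ?sqr_ge0 // mulr_ge0.
  have [yx|yx] := ltP `|y - x| d.
    by apply: (le_trans (ltW (hd _ _ x01 yx))); rewrite mulr1 lerDl.
  apply: (@le_trans _ _ (2 * M)).
    apply: (le_trans (ler_normB _ _)); have := hM _ y01; have := hM _ x01; lra.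
  apply: (@le_trans _ _ (2 * M * ((y - x) / d) ^+ 2)); last by lra.
  rewrite ler_peMr ?mulr_ge0 // -real_normK ?num_real // exprn_ege1 //.
  by rewrite normrM normfV [`|d|]gtr0_norm // ler_pdivlMr // mul1r.
have e1 : bernstein n x (fun j => 1 * f (j%:R / n%:R) + (- f x) * 1) =
    bernstein n x (fun j => f (j%:R / n%:R)) - f x.
  by rewrite bernsteinD bernstein_cst mulr1 mul1r.
have e2 : bernstein n x (fun j => (-1) * f (j%:R / n%:R) + f x * 1) =
    f x - bernstein n x (fun j => f (j%:R / n%:R)).
  by rewrite bernsteinD bernstein_cst mulr1 mulN1r addrC.
rewrite ler_norml lerNl opprB -e1 -e2; apply/andP; split; apply: bound => j jn.
  by apply: le_trans (close j jn); rewrite mul1r mulr1 ler_norm.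
apply: le_trans (close j jn); rewrite mulN1r mulr1 addrC distrC; exact: ler_norm.
Qed.

End Bernstein.

Lemma weierstrass_approx (R : realType) (f : R -> R) (al be e : R) :
  continuous f -> 0 < e ->
  exists P : {poly R}, forall x, al <= x <= be -> `|f x - P.[x]| <= e.
Proof.
move=> cf e0; have [ba|ab] := leP be al.
  exists (f al)%:P => x /andP[ax xb]; rewrite hornerC.
  have -> : x = al by apply/eqP; rewrite eq_le ax (le_trans xb ba).
  by rewrite subrr normr0 ltW.
have ab0 : 0 < be - al by rewrite subr_gt0.
have cg : continuous (fun u : R => f (al + u * (be - al))).
  move=> u; apply: continuous_comp; last exact: cf.
  by apply: cvgD; [exact: cvg_cst | apply: cvgMl; exact: cvg_id].
have [P hP] := bernstein_approx cg e0.
exists (P \Po ((be - al)^-1 *: ('X - al%:P))) => x /andP[ax xb].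
have := hP ((be - al)^-1 * (x - al)).
rewrite horner_comp !hornerE -mulrA [(x - al) * _]mulrC mulrA mulVf ?gt_eqF //.
rewrite mul1r [al + _]addrC subrK; apply.
rewrite mulr_ge0 ?invr_ge0 ?(ltW ab0) ?subr_ge0 //= mulrC ler_pdivrMr // mul1r.
by rewrite lerB.
Qed.

Definition seq_mean (T : Type) (R : realType) (s : seq T) (f : T -> R) : R :=
  (size s)%:R^-1 * \sum_(x <- s) f x.

(** * Limits of quantile functions *)

Section StepFunction.
Variable R : realType.
Implicit Types (t : seq R) (u : R).

Local Notation mu := (@lebesgue_measure R).

Definition cell (N i : nat) : set R := `[i%:R / N%:R, i.+1%:R / N%:R[%classic.

Lemma cell_exists N u : (0 < N)%N -> 0 <= u < 1 ->
  exists2 i, (i < N)%N & cell N i u.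
Proof.
move=> N0 /andP[u0 u1]; have NR : 0 < N%:R :> R by rewrite ltr0n.
have uN : 0 <= u * N%:R by rewrite mulr_ge0.
have /andP[h1 h2] := truncn_itv uN.
exists (Num.trunc (u * N%:R)).
  by rewrite -(ltr_nat R); apply: le_lt_trans h1 _; rewrite gtr_pMl.
by rewrite /cell /= in_itv /= ler_pdivrMr // ltr_pdivlMr // h1.
Qed.

Lemma cell_inj N i j u : (0 < N)%N -> cell N i u -> cell N j u -> i = j.
Proof.
move=> N0; have NR : 0 < N%:R :> R by rewrite ltr0n.
have h a b : cell N a u -> cell N b u -> (a <= b)%N.
  rewrite /cell /= !in_itv /= => /andP[h1 _] /andP[_ h2].
  by have := le_lt_trans h1 h2; rewrite ltr_pM2r ?invr_gt0 // ltr_nat ltnS.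
by move=> ui uj; apply/eqP; rewrite eqn_leq !h.
Qed.

Lemma measurable_cell N i : measurable (cell N i).
Proof. exact: measurable_itv. Qed.

Lemma measure_cell N i : (0 < N)%N -> (i < N)%N ->
  mu (cell N i `&` `[0, 1[%classic) = (N%:R^-1)%:E.
Proof.
move=> N0 iN; have NR : 0 < N%:R :> R by rewrite ltr0n.
have -> : cell N i `&` `[0, 1[%classic = cell N i.
  apply/setIidl => u; rewrite /cell /= !in_itv /= => /andP[h1 h2].
  apply/andP; split; first by apply: le_trans h1; rewrite divr_ge0.
  by apply: (lt_le_trans h2); rewrite ler_pdivrMr // mul1r ler_nat.
rewrite lebesgue_measure_itv /= lte_fin ltr_pM2r ?invr_gt0 // ltr_nat ltnSn.
by rewrite -EFinD -mulrBl -natrB // subSnn mul1r.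
Qed.

Definition step_fun N (c : nat -> R) u : R :=
  \sum_(i < N) c i * \1_(cell N i) u.

Lemma step_funE N c i u : (0 < N)%N -> (i < N)%N -> cell N i u ->
  step_fun N c u = c i.
Proof.
move=> N0 iN ui; rewrite /step_fun (bigD1 (Ordinal iN)) //= indicE mem_set //.
rewrite mulr1 big1 ?addr0 // => j ji; rewrite indicE memNset ?mulr0 // => uj.
by move/eqP: ji; apply; apply: val_inj; exact: (cell_inj N0 uj ui).
Qed.

Lemma measurable_step_fun N c : measurable_fun setT (step_fun N c).
Proof.
apply: measurable_sum => i; apply: measurable_funM => //.
by apply: measurable_indic; exact: measurable_cell.
Qed.

Lemma integral_step_fun N c : (0 < N)%N ->
  (\int[mu]_(u in `[0%R, 1%R[) (step_fun N c u)%:E)%E =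
  (N%:R^-1 * \sum_(i < N) c i)%:E.
Proof.
move=> N0; have m01 : measurable (`[0, 1[%classic : set R) by exact: measurable_itv.
have fin01 : (mu `[0%R, 1%R[%classic < +oo)%E.
  by rewrite lebesgue_measure_itv /= lte_fin ltr01 -EFinD ltry.
have ind i : mu.-integrable `[0, 1[%classic (fun u => (\1_(cell N i) u)%:E).
  apply: measurable_bounded_integrable => //.
    by apply: measurable_indic; exact: measurable_cell.
  exists 1; split; rewrite ?num_real // => x x1 u _ /=; rewrite indicE.
  by case: (_ \in _); rewrite ?normr1 ?normr0 ltW // (lt_trans ltr01).
transitivity (\int[mu]_(u in `[0%R, 1%R[)
    (\sum_(i < N) ((c i)%:E * (\1_(cell N i) u)%:E)))%E.
  by apply: eq_integral => u _; rewrite /step_fun -sumEFin.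
rewrite integral_sum //; last first.
  by move=> i; exact: integrableZl.
rewrite mulr_sumr -sumEFin; apply: eq_bigr => i _.
rewrite integralZl // integral_indic //; last exact: measurable_cell.
transitivity ((c i)%:E * (N%:R^-1)%:E)%E; last by rewrite -EFinM mulrC.
by congr (_ * _)%E; exact: measure_cell.
Qed.

Lemma comp_step_fun N c (psi : R -> R) u : (0 < N)%N -> 0 <= u < 1 ->
  psi (step_fun N c u) = step_fun N (psi \o c) u.
Proof.
move=> N0 /(cell_exists N0)[i iN ui]; rewrite (step_funE _ N0 iN ui).
by rewrite (step_funE _ N0 iN ui).
Qed.

Lemma integral_comp_step_fun N c (psi : R -> R) : (0 < N)%N ->
  (\int[mu]_(u in `[0%R, 1%R[) (psi (step_fun N c u))%:E)%E =
  (N%:R^-1 * \sum_(i < N) psi (c i))%:E.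
Proof.
move=> N0; rewrite -(integral_step_fun (psi \o c) N0); apply: eq_integral => u.
by rewrite inE /= in_itv /= => u01; rewrite comp_step_fun.
Qed.

End StepFunction.

Section Oscillation.
Variable R : realType.
Implicit Types (v : nat -> R) (x y : R).

(** A bounded sequence that does not converge crosses some interval with rational ends infinitely
    often; there are countably many such intervals, which keeps the exceptional set countable. *)
Definition oscillates v x y : Prop :=
  (forall N, exists2 n, (N <= n)%N & v n < x) /\
  (forall N, exists2 n, (N <= n)%N & y < v n).

Lemma cvg_of_oscillates v (al be : R) : (forall n, al <= v n <= be) ->
  (forall p q : rat, p < q -> ~ oscillates v (ratr p) (ratr q)) ->
  exists2 l, al <= l <= be & v @ \oo --> l.
Proof.
move=> hv nosc.
(* [sup A] is the lower limit of v. If v were at least [sup A + e] infinitely often, it would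
   oscillate across a rational interval inside ]sup A, sup A + e[. *)
pose A := [set x : R | exists N, forall n, (N <= n)%N -> x <= v n].
have supA : has_sup A.
  split; first by exists al; exists 0%N => n _; case/andP: (hv n).
  exists be => x [N /(_ N (leqnn N)) h]; apply: (le_trans h).
  by case/andP: (hv N).
exists (sup A).
  apply/andP; split.
    by apply: ub_le_sup; [exact: supA.2 | exists 0%N => n _; case/andP: (hv n)].
  apply: ge_sup; first exact: supA.1.
  by move=> x [N /(_ N (leqnn N)) h]; apply: (le_trans h); case/andP: (hv N).
apply/cvgrPdist_lt => e e0.
have [x [N1 hN1] hx] := sup_adherent e0 supA.
have [N2 hN2] : exists N2, forall n, (N2 <= n)%N -> v n < sup A + e.
  apply: contrapT => hN.
  have lt1 : sup A < sup A + e by rewrite ltrDl.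
  have [q] := rat_in_itvoo lt1; rewrite in_itv /= => /andP[Aq qe].
  have [p] := rat_in_itvoo Aq; rewrite in_itv /= => /andP[Ap pq].
  rewrite ltr_rat in pq; apply: (nosc p q pq); split=> N; apply: contrapT => h.
    have : A (ratr p).
      exists N => n Nn; rewrite leNgt; apply/negP => vp; apply: h; by exists n.
    by move/(ub_le_sup supA.2); rewrite leNgt Ap.
  apply: hN; exists N => n Nn; rewrite ltNge; apply/negP => ve.
  by apply: h; exists n => //; exact: lt_le_trans ve.
near=> n; rewrite ltr_distlC.
have n1 : (N1 <= n)%N by near: n; exact: nbhs_infty_ge.
have n2 : (N2 <= n)%N by near: n; exact: nbhs_infty_ge.
by rewrite hN2 // andbT; apply: (lt_le_trans hx); exact: hN1.
Unshelve. all: end_near. Qed.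

End Oscillation.

Lemma perm_seq_mean (T : eqType) (R : realType) (s t : seq T) (f : T -> R) :
  perm_eq s t -> seq_mean s f = seq_mean t f.
Proof. by move=> st; rewrite /seq_mean (perm_size st) (perm_big _ st). Qed.

Section Quantile.
Variables (R : realType) (s : nat -> seq R) (al be : R).
Hypothesis alb : al <= be.
Hypothesis size_s : forall n, size (s n) = n.+1.
Hypothesis s_itv : forall n x, x \in s n -> al <= x <= be.
Hypothesis mean_cvg : forall psi : R -> R, continuous psi ->
  cvgn (fun n => seq_mean (s n) psi).

Local Notation mu := (@lebesgue_measure R).

(* The quantile function of the empirical measure of s n. *)
Let q (n : nat) (u : R) : R := step_fun n.+1 (nth al (sort <=%O (s n))) u.

Let size_sort_s n : size (sort <=%O (s n)) = n.+1.
Proof. by rewrite size_sort size_s. Qed.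

Let nth_itv n i : (i < n.+1)%N -> al <= nth al (sort <=%O (s n)) i <= be.
Proof.
move=> i_n; apply: (s_itv (n := n)); rewrite -(mem_sort <=%O).
by apply: mem_nth; rewrite size_sort_s.
Qed.

Let q_itv n u : 0 <= u < 1 -> al <= q n u <= be.
Proof.
move=> /(cell_exists (ltn0Sn n))[i iN ui].
by rewrite /q (step_funE _ _ iN ui) // nth_itv.
Qed.

Let sorted_le n i j : (i <= j)%N -> (j < n.+1)%N ->
  nth al (sort <=%O (s n)) i <= nth al (sort <=%O (s n)) j.
Proof.
move=> ij jn.
apply: (sorted_leq_nth (@le_trans _ R) (@lexx _ R)) => //.
- exact: sort_le_sorted.
- by rewrite inE size_sort_s; exact: leq_ltn_trans jn.
- by rewrite inE size_sort_s.
Qed.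

Let mean_sort n (psi : R -> R) : seq_mean (s n) psi =
  n.+1%:R^-1 * \sum_(i < n.+1) psi (nth al (sort <=%O (s n)) i).
Proof.
have pe : perm_eq (s n) (sort <=%O (s n)) by rewrite perm_sym perm_sort.
rewrite (perm_seq_mean _ pe) /seq_mean size_sort_s (big_nth al) big_mkord.
by rewrite size_sort_s.
Qed.

(** When the quantile at u exceeds y, only the points of index below i, with i / (n + 1) <= u, can
    contribute to the mean of psi. *)
Let mean_le n u y (psi : R -> R) : 0 <= u < 1 ->
  (forall t, 0 <= psi t <= 1) -> (forall t, y <= t -> psi t = 0) ->
  y < q n u -> seq_mean (s n) psi <= u.
Proof.
move=> u01 psi01 psiy; have [i iN ui] := cell_exists (ltn0Sn n) u01.
rewrite /q (step_funE _ _ iN ui) // => yq; rewrite mean_sort.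
have nR : 0 < n.+1%:R :> R by rewrite ltr0n.
rewrite mulrC ler_pdivrMr //; apply: (@le_trans _ _ i%:R); last first.
  by move: ui; rewrite /cell /= in_itv /= => /andP[]; rewrite ler_pdivrMr.
rewrite (bigID (fun j : 'I_n.+1 => (j < i)%N)) /=.
rewrite [X in _ + X]big1 ?addr0 => [|j]; last first.
  rewrite -leqNgt => ij; apply: psiy; apply: (le_trans (ltW yq)).
  exact: sorted_le.
apply: (@le_trans _ _ (\sum_(j < n.+1 | (j < i)%N) 1)).
  by apply: ler_sum => j _; case/andP: (psi01 (nth al (sort <=%O (s n)) j)).
rewrite -(big_ord_widen _ (fun=> 1) (ltnW iN)) sumr_const card_ord //.
Qed.

Let mean_ge n u x (psi : R -> R) : 0 <= u < 1 ->
  (forall t, 0 <= psi t <= 1) -> (forall t, t <= x -> psi t = 1) ->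
  q n u < x -> u <= seq_mean (s n) psi.
Proof.
move=> u01 psi01 psix; have [i iN ui] := cell_exists (ltn0Sn n) u01.
rewrite /q (step_funE _ _ iN ui) // => yq; rewrite mean_sort.
have nR : 0 < n.+1%:R :> R by rewrite ltr0n.
rewrite mulrC ler_pdivlMr //; apply: (@le_trans _ _ i.+1%:R).
  by move: ui; rewrite /cell /= in_itv /= => /andP[_]; rewrite ltr_pdivlMr // => /ltW.
rewrite (bigID (fun j : 'I_n.+1 => (j < i.+1)%N)) /=.
apply: (@le_trans _ _ (\sum_(j < n.+1 | (j < i.+1)%N) 1)).
  by rewrite -(big_ord_widen _ (fun=> 1) iN) sumr_const card_ord.
rewrite -[leLHS]addr0; apply: lerD.
  apply: ler_sum => j ji; rewrite psix //; apply: le_trans (ltW yq).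
  exact: sorted_le.
by rewrite sumr_ge0 // => j _; case/andP: (psi01 (nth al (sort <=%O (s n)) j)).
Qed.

(** For a cutoff psi falling from 1 to 0 between x and y, oscillation at u makes the mean of psi at
    most u infinitely often, and oscillation at v makes it at least v infinitely often; with u < v
    the means could not converge. *)
Let oscillates_unique x y u v : x < y -> 0 <= u < 1 -> 0 <= v < 1 ->
  oscillates (q ^~ u) x y -> oscillates (q ^~ v) x y -> ~ (u < v).
Proof.
move=> xy u01 v01 [_ uy] [vx _] uv.
have yx : 0 < y - x by rewrite subr_gt0.
pose w (t : R) := (y - t) / (y - x).
(* This is [w t] clamped to [0, 1], written so that continuity is immediate. *)
pose psi (t : R) := (`|w t| - `|w t - 1| + 1) / 2.
have psi01 t : 0 <= psi t <= 1.
  by rewrite /psi; case: (ger0P (w t)) => ?; case: (ger0P (w t - 1)) => ?; lra.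
have psix t : t <= x -> psi t = 1.
  move=> tx; have w1 : 1 <= w t by rewrite /w ler_pdivlMr // mul1r lerB.
  by rewrite /psi !ger0_norm; lra.
have psiy t : y <= t -> psi t = 0.
  move=> yt; have w0 : w t <= 0.
    by rewrite /w pmulr_lle0 ?invr_gt0 // subr_le0.
  by rewrite /psi !ler0_norm; lra.
have cw : continuous w.
  by move=> t; apply: cvgMl; apply: cvgB; [exact: cvg_cst | exact: cvg_id].
have cpsi : continuous psi.
  move=> t; apply: cvgMl; apply: cvgD; last exact: cvg_cst.
  apply: cvgB; apply: cvg_norm; first exact: cw.
  by apply: cvgB; [exact: cw | exact: cvg_cst].
have /cvg_ex[/= L /cvgrPdist_lt hL] := mean_cvg cpsi.
have e0 : 0 < (v - u) / 2 by rewrite divr_gt0 // subr_gt0.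
have [N _ hN] := hL _ e0.
have [n1 Nn1 /(mean_le u01 psi01 psiy) h1] := uy N.
have [n2 Nn2 /(mean_ge v01 psi01 psix) h2] := vx N.
have := hN n1 Nn1; have := hN n2 Nn2; rewrite /= !ltr_norml; lra.
Qed.

Lemma quantile_limit : exists g : R -> R, [/\ measurable_fun setT g,
  forall u, al <= g u <= be & forall psi : R -> R, continuous psi ->
    (seq_mean (s n) psi)%:E @[n --> \oo] -->
    (\int[mu]_(u in `[0%R, 1%R[) (psi (g u))%:E)%E].
Proof.
pose E0 (pr : rat * rat) := [set u : R | 0 <= u < 1 /\ pr.1 < pr.2 /\
  oscillates (q ^~ u) (ratr pr.1) (ratr pr.2)].
pose E := \bigcup_pr E0 pr.
have cE : countable E.
  apply: bigcup_countable => [|pr _]; first exact: countableP.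
  have [->|/set0P[u [u01 [pr12 ou]]]] := eqVneq (E0 pr) set0.
    exact: countable0.
  (* Each rational pair contributes at most one point, by [oscillates_unique] used in both
     directions. *)
  apply: (@sub_countable _ _ _ [set u]); last exact: countable1.
  apply: subset_card_le => v [v01 [_ ov]] /=.
  have pr12R : ratr pr.1 < ratr pr.2 :> R by rewrite ltr_rat.
  have := oscillates_unique pr12R u01 v01 ou ov.
  have := oscillates_unique pr12R v01 u01 ov ou.
  move=> /negP; rewrite -leNgt => h1 /negP; rewrite -leNgt => h2.
  by apply/eqP; rewrite eq_le h1 h2.
have mE : measurable E.
  by apply: countable_measurable => // u; exact: measurable_set1.
have m01 : measurable (`[0, 1[%classic : set R) by exact: measurable_itv.
pose D : set R := `[0, 1[%classic `\` E.
have mD : measurable D by exact: measurableD.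
have D01 u : D u -> 0 <= u < 1 by case; rewrite /= in_itv.
have cvD u : D u -> exists2 l, al <= l <= be & q ^~ u @ \oo --> l.
  move=> Du; have u01 := D01 _ Du.
  apply: cvg_of_oscillates => [n|p r pr osc]; first exact: q_itv.
  by case: Du => _; apply; exists (p, r).
pose f0 := (fun u => lim (q ^~ u @ \oo)) \_ D.
(* Clamping puts g in [al, be] at every u, including the exceptional set and the points outside [0,
   1[. *)
pose g u := Num.max al (Num.min be (f0 u)).
have f0D u : D u -> q ^~ u @ \oo --> f0 u.
  move=> Du; rewrite /f0 patchE mem_set //.
  by have [l _ ql] := cvD _ Du; rewrite (cvg_lim _ ql).
have gD u : D u -> q ^~ u @ \oo --> g u.
  move=> Du; have [l /andP[al_l lbe] ql] := cvD _ Du.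
  have f0l : f0 u = l by apply: cvg_unique ql => //; exact: f0D.
  by rewrite /g f0l min_r // max_r.
have mq n D' : measurable_fun D' (q n).
  by apply: measurable_funTS; exact: measurable_step_fun.
have mf0 : measurable_fun setT f0.
  apply/(measurable_restrictT _ mD).
  apply: (measurable_fun_cvg (h := q)) => [n|u Du]; first exact: mq.
  by have := f0D _ Du; rewrite /f0 patchE mem_set.
have mg : measurable_fun setT g.
  apply: measurable_maxr; first exact: measurable_cst.
  by apply: measurable_minr => //; exact: measurable_cst.
exists g; split=> // [u|psi cpsi].
  by rewrite /g le_max lexx /= ge_max alb /= ge_min lexx.
have mpsi : measurable_fun setT psi by exact: continuous_measurable_fun.
have eqm n : (seq_mean (s n) psi)%:E =
    (\int[mu]_(u in `[0%R, 1%R[) (psi (q n u))%:E)%E.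
  by rewrite integral_comp_step_fun // mean_sort.
under eq_cvg do rewrite eqm.
have [M hM] : exists M : R, forall x, al <= x <= be -> `|psi x| <= M.
  have [] := compact_bounded (continuous_compact (continuous_subspaceT cpsi)
    (@segment_compact _ al be)).
  move=> M [_ /(_ (M + 1))]; rewrite ltrDl ltr01 => /(_ isT) h.
  by exists (M + 1) => x x01; apply: h; exists x => //=; rewrite in_itv.
have [] := @dominated_convergence _ _ _ mu `[0%R, 1%R[%classic m01
  (fun n u => (psi (q n u))%:E) (fun u => (psi (g u))%:E) (cst M%:E).
- move=> n; apply/measurable_EFinP/measurableT_comp => //; exact: mq.
- apply/measurable_EFinP/measurableT_comp => //; exact: measurable_funTS.
- exists E; split => //; first exact: countable_lebesgue_measure0.
  move=> u /= /not_implyP[u01 ncv]; apply: contrapT => nEu; apply: ncv.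
  by apply: cvg_EFin; [exact: nearW | apply: continuous_cvg;
    [exact: cpsi | exact: gD]].
- have -> : cst M%:E = EFin \o (cst M : R -> R) by [].
  have mu01 : (mu (`[0%R, 1%R[%classic : set R) < +oo)%E.
    by rewrite lebesgue_measure_itv /= lte_fin ltr01 -EFinD ltry.
  apply: measurable_bounded_integrable => //.
  exists `|M|; split; rewrite ?num_real // => x /ltW Mx u _ /=.
  exact: Mx.
- apply: aeW => u n; rewrite /= in_itv /= => u01; rewrite lee_fin.
  by apply: hM; exact: q_itv.
- by [].
Qed.

End Quantile.

(** * Convergence of the means over the roots *)

Section Means.
Variable R : realType.
Implicit Types (u : nat -> R) (l e C : R).

Lemma cvg_harmonic_bound u l C :
  (exists N, forall n, (N <= n)%N -> `|u n - l| <= C / n%:R) -> u @ \oo --> l.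
Proof.
move=> [N hN]; apply/cvgrPdist_le => e e0; near=> n.
rewrite distrC; apply: (@le_trans _ _ (C / n%:R)).
  by apply: hN; near: n; exact: nbhs_infty_ge.
have n0 : (0 < n)%N by near: n; exact: nbhs_infty_gt.
rewrite ler_pdivrMr ?ltr0n // mulrC -ler_pdivrMr //.
by near: n; exact: nbhs_infty_ger.
Unshelve. all: by end_near. Qed.

Lemma cvgn_of_approx u :
  (forall e, 0 < e -> exists l N, forall n, (N <= n)%N -> `|u n - l| <= e) ->
  cvgn u.
Proof.
move=> h; apply: cauchy_cvg; apply: cauchy_exP => e e0.
have [|l [N hN]] := h (e / 2); first by rewrite divr_gt0.
exists l; exists N => // n /= Nn; rewrite /ball /= distrC.
by apply: le_lt_trans (hN n Nn) _; rewrite ltr_pdivrMr // ltr_pMr // ltr1n.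
Qed.

(** The centre l' may depend on e but is common to u and v; in this way two operators with the same
    leading zeros are compared. *)
Lemma cvg_of_approx u v l :
  (forall e, 0 < e -> exists l' N, forall n, (N <= n)%N ->
     `|u n - l'| <= e /\ `|v n - l'| <= e) ->
  u @ \oo --> l -> v @ \oo --> l.
Proof.
move=> h /cvgrPdist_le ul; apply/cvgrPdist_le => e e0.
have e3 : 0 < e / 3 by rewrite divr_gt0.
have [l' [N hN]] := h _ e3; have {}ul := ul _ e3.
near=> n; have [h1 h2] : `|u n - l'| <= e / 3 /\ `|v n - l'| <= e / 3.
  by apply: hN; near: n; exact: nbhs_infty_ge.
have h3 : `|l - u n| <= e / 3 by near: n.
have -> : l - v n = (l - u n) + (u n - l') - (v n - l') by ring.
apply: (le_trans (ler_normB _ _)); rewrite (_ : e = e / 3 + e / 3 + e / 3); last by field.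
by rewrite lerD // (le_trans (ler_normD _ _)) // lerD.
Unshelve. all: by end_near. Qed.

Lemma seq_meanB (T : Type) (s : seq T) (f g : T -> R) :
  seq_mean s f - seq_mean s g = seq_mean s (fun x => f x - g x).
Proof. by rewrite /seq_mean -mulrBr sumrB. Qed.

Lemma seq_mean_le (T : eqType) (s : seq T) (f : T -> R) e : 0 <= e ->
  {in s, forall x, `|f x| <= e} -> `|seq_mean s f| <= e.
Proof.
move=> e0 fe; rewrite /seq_mean normrM ger0_norm ?invr_ge0 //.
have [->|s0] := eqVneq s [::]; first by rewrite big_nil normr0 mulr0.
rewrite mulrC ler_pdivrMr ?ltr0n ?lt0n ?size_eq0 //.
apply: (le_trans (ler_norm_sum _ _ _)).
apply: (@le_trans _ _ (\sum_(x <- s) e)).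
  by rewrite big_seq [leRHS]big_seq; apply: ler_sum.
by rewrite big_const_seq count_predT iter_addr_0 mulr_natr.
Qed.

Lemma seq_mean_map (S T : Type) (s : seq S) (h : S -> T) (f : T -> R) :
  seq_mean (map h s) f = seq_mean s (f \o h).
Proof. by rewrite /seq_mean size_map big_map. Qed.

End Means.

Section ComplexPlane.
Variable R : realType.
Implicit Types (z a b : R[i]).

Lemma norm_complexE (z : (R[i])^o) : `|z| = (normc z)%:C.
Proof. by []. Qed.

Lemma pos_complexP (e : R[i]) : 0 < e -> exists2 r : R, 0 < r & e = r%:C.
Proof.
case: e => x y; rewrite ltcE /= => /andP[/eqP -> x0].
by exists x.
Qed.

Lemma continuous_real_complex : continuous (real_complex R : R -> (R[i])^o).
Proof.
move=> x; apply/cvgrPdist_le => _ /pos_complexP[e e0 ->].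
near=> y; rewrite norm_complexE -rmorphB normc_real lecR.
near: y; exact: (@cvgr_dist_le _ _ _ _ _ id x).
Unshelve. all: by end_near. Qed.

Lemma continuous_Re : continuous (@complex.Re R : (R[i])^o -> R).
Proof.
move=> x; apply/(@cvgrPdist_le _ R^o _ (nbhs x)) => e e0; near=> y.
rewrite -raddfB; apply: (le_trans (normc_Re _)).
rewrite -lecR -norm_complexE; near: y.
by apply: (@cvgr_dist_le _ _ _ _ _ id x) => //; rewrite ltcR.
Unshelve. all: by end_near. Qed.

Lemma continuous_complex_horner (P : {poly R[i]}) :
  continuous (horner P : (R[i])^o -> (R[i])^o).
Proof.
move=> z; elim/poly_ind: P => [|P c ih].
  rewrite (_ : horner _ = fun _ : (R[i])^o => 0); last first.
    by apply/funext => x; rewrite horner0.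
  exact: (@cst_continuous (R[i])^o (R[i])^o 0 z).
rewrite (_ : horner _ = fun x : (R[i])^o => P.[x] * x + c); last first.
  by apply/funext => x; rewrite hornerMXaddC.
apply: (@cvgD _ (R[i])^o _ (nbhs z)); 
  last exact: (@cst_continuous (R[i])^o (R[i])^o c z).
by apply: (@cvgM (R[i]) _ (nbhs z)); [exact: ih | exact: cvg_id].
Qed.

Lemma continuous_Re_horner (P : {poly R[i]}) :
  continuous (fun z : (R[i])^o => complex.Re P.[z]).
Proof.
move=> z; apply: (@continuous_comp _ _ _ (horner P : (R[i])^o -> (R[i])^o)).
  exact: continuous_complex_horner.
exact: continuous_Re.
Qed.

Lemma continuous_line a b : continuous (fun t : R => (a + t%:C * b) : (R[i])^o).
Proof.
move=> t; apply: (@cvgD _ (R[i])^o _ (nbhs t)); first exact: cvg_cst.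
by apply: (@cvgM (R[i]) _ (nbhs t)); [exact: continuous_real_complex | exact: cvg_cst].
Qed.

End ComplexPlane.

Lemma Re_realM (R : realType) (c : R) (z : R[i]) :
  complex.Re (c%:C * z) = c * complex.Re z.
Proof. by case: z => x y; simpc. Qed.

Lemma normc_le_ReIm (R : realType) (z : R[i]) :
  normc z <= `|complex.Re z| + `|complex.Im z|.
Proof.
have h : 0 <= `|complex.Re z| + `|complex.Im z| by rewrite addr_ge0.
rewrite -(@ler_pXn2r _ 2) ?nnegrE ?normc_ge0 // normc_sqr sqrrD !real_normK ?num_real //.
by rewrite lerD2r lerDl mulrn_wge0 // mulr_ge0.
Qed.

(** * Leading zeros on a line: projection of the roots *)

Section Line.
Variables (R : realType) (k : nat) (xi : 'I_k.+1 -> R[i]) (a b : R[i]).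
Variables (t : 'I_k.+1 -> R) (al be : R).
Hypotheses (k0 : (0 < k)%N) (b0 : b != 0).
Hypothesis xiE : forall j, xi j = a + (t j)%:C * b.
Hypothesis t_itv : forall j, al <= t j <= be.

Local Notation Qm := (\prod_j ('X - (xi j)%:P)).

Section Localization.
Variable Q : nat -> {poly R[i]}.
Hypotheses (hQ : heun_operator k Q) (hQm : Q k = lead_coef (Q k) *: Qm).

Lemma van_vleck_root_line_disc (m L T e : R) :
  (forall j, `|t j - m| <= L) -> 0 < e -> exists N, forall n, (N <= n)%N ->
  forall z, van_vleck_root k Q n z ->
    normc ((z - a) / b - (m +i* T)) < Num.sqrt (L ^+ 2 + T ^+ 2) + e.
Proof.
move=> tm e0; have nb : 0 < normc b by rewrite normc_gt0.
have [|j|N hN] := @van_vleck_root_disc R k Q xi (a + (m +i* T) * b)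
    (normc b * Num.sqrt (L ^+ 2 + T ^+ 2)) (normc b * e) k0 hQ hQm _
    (mulr_gt0 nb e0).
- by rewrite mulr_ge0 ?sqrtr_ge0 ?normc_ge0.
- rewrite xiE opprD addrACA subrr add0r -mulrBl normcM mulrC ler_wpM2l ?normc_ge0 //.
  rewrite -[leLHS]ger0_norm ?normc_ge0 // -sqrtr_sqr ler_wsqrtr // normc_sqr /=.
  rewrite sub0r sqrrN lerD2r -(real_normK (num_real (t j - m))).
  by rewrite lerXn2r ?nnegrE // (le_trans (normr_ge0 (t j - m))).
exists N => n nN z /(hN n nN z); rewrite -mulrDr.
have -> : z - (a + (m +i* T) * b) = b * ((z - a) / b - (m +i* T)).
  by rewrite mulrBr mulrCA mulfV // mulr1 opprD addrA [b * _]mulrC.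
by rewrite normcM ltr_pM2l.
Qed.

(** The disc centred at the midpoint m of the segment bounds the real part. The one centred at m - i
    T rises above the line by at most d, which bounds the imaginary part from above; the one centred
    at m + i T bounds it from below. *)
Lemma van_vleck_root_line d : 0 < d -> exists N, forall n, (N <= n)%N ->
  forall z, van_vleck_root k Q n z -> let w := (z - a) / b in
    `|complex.Im w| <= d /\ al - d <= complex.Re w <= be + d.
Proof.
move=> d0; pose m := (al + be) / 2; pose L := (be - al) / 2.
have tm j : `|t j - m| <= L.
  by have /andP[h1 h2] := t_itv j; rewrite ler_norml /m /L; apply/andP; split; lra.
have L0 : 0 <= L by apply: le_trans (tm ord0).
have d2 : 0 < d / 2 by rewrite divr_gt0.
(* T >= L^2 / d gives sqrt (L^2 + T^2) <= T + d / 2; adding 1 keeps T positive when L = 0. *)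
pose T := L ^+ 2 / d + 1.
have T0 : 0 < T by rewrite ltr_wpDl // divr_ge0 ?sqr_ge0 // ltW.
have sqT : Num.sqrt (L ^+ 2 + T ^+ 2) <= T + d / 2.
  have Td : 0 <= T + d / 2 by rewrite addr_ge0 ?ltW.
  rewrite -[leRHS]ger0_norm // -sqrtr_sqr ler_wsqrtr //.
  have Ld : L ^+ 2 <= T * d by rewrite /T mulrDl divfK ?gt_eqF // lerDl mul1r ltW.
  nra.
have [N1 h1] := van_vleck_root_line_disc 0 tm d2.
have [N2 h2] := van_vleck_root_line_disc T tm d2.
have [N3 h3] := van_vleck_root_line_disc (- T) tm d2.
exists (maxn N1 (maxn N2 N3)) => n; rewrite !geq_max => /and3P[n1 n2 n3] z zr w.
have {}h1 := h1 n n1 z zr; have {}h2 := h2 n n2 z zr; have {}h3 := h3 n n3 z zr.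
rewrite expr0n addr0 sqrtr_sqr ger0_norm // in h1; rewrite sqrrN in h3.
have := le_lt_trans (normc_Re _) h1; rewrite raddfB /= -/w.
have := le_lt_trans (normc_Im _) h2; rewrite raddfB /= -/w.
have := le_lt_trans (normc_Im _) h3; rewrite raddfB /= -/w.
rewrite !ltr_norml => /andP[_ i1] /andP[i2 _] /andP[r1 r2].
split; first by rewrite ler_norml; apply/andP; split; lra.
move: r1 r2; rewrite /m /L => r1 r2; apply/andP; split; lra.
Qed.

End Localization.

(** The future integral of P against the limit measure, obtained by linearity from the limits of the
    normalized traces. *)
Definition moment_functional (P : {poly R[i]}) : R[i] :=
  \sum_(i < size P) P`_i * limit_moment k Qm i.

Lemma cvg_mean_roots Q (P : {poly R[i]}) : heun_operator k Q ->
  Q k = lead_coef (Q k) *: Qm ->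
  seq_mean (poly_roots (spectral_poly k Q n)) (fun z => complex.Re P.[z])
    @[n --> \oo] --> complex.Re (moment_functional P).
Proof.
move=> hQ hQm; have Qmm : Qm \is monic by exact: monic_prod_XsubC.
pose v i n := complex.Re (P`_i * (n.+1%:R^-1 * \tr (shifted_mx k Q n ^+ i))).
have cv i : v i @ \oo --> complex.Re (P`_i * limit_moment k Qm i).
  have [C C0 [N hN]] := trace_limit k0 hQ hQm Qmm i.
  apply: (@cvg_harmonic_bound _ _ _ (normc P`_i * C)); exists N => n nN.
  rewrite /v -raddfB -mulrBr; apply: (le_trans (normc_Re _)).
  by rewrite normcM -mulrA ler_wpM2l ?normc_ge0 // hN.
have cS : \sum_(i < size P) v i n @[n --> \oo] --> complex.Re (moment_functional P).
  rewrite /moment_functional raddf_sum /=.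
  apply: cvg_big => [|i _]; last exact: cv.
  by move=> x; apply: cvgD; [exact: cvg_fst | exact: cvg_snd].
apply: cvg_trans cS; apply: near_eq_cvg.
have [N hN] := spectral_roots k0 hQ; near=> n.
have [_ sz _ tr] : let s := poly_roots (spectral_poly k Q n) in
    [/\ size (spectral_poly k Q n) = n.+2, size s = n.+1,
      {in s, forall x, van_vleck_root k Q n x}
    & forall p, \sum_(x <- s) x ^+ p = \tr (shifted_mx k Q n ^+ p)].
  by apply: hN; near: n; exact: nbhs_infty_ge.
rewrite /seq_mean sz /v -!raddf_sum -Re_realM fmorphV rmorph_nat /=.
rewrite mulr_sumr; congr complex.Re.
under eq_bigr do rewrite -tr mulrCA; rewrite -!mulr_sumr; congr (_ * _).
under eq_bigr do rewrite mulr_sumr; rewrite exchange_big /=.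
by apply: eq_bigr => z _; rewrite horner_coef.
Unshelve. all: by end_near. Qed.

Definition clamp (x : R) := Num.max al (Num.min be x).

Let alb : al <= be.
Proof. by have /andP[h1 h2] := t_itv ord0; apply: le_trans h1 h2. Qed.

Lemma clamp_itv x : al <= clamp x <= be.
Proof. by rewrite /clamp le_max lexx /= ge_max alb /= ge_min lexx. Qed.

Lemma clamp_dist d x : 0 <= d -> al - d <= x <= be + d -> `|x - clamp x| <= d.
Proof.
move=> d0 /andP[h1 h2]; rewrite /clamp ler_norml; apply/andP.
by case: (ltP be x) => hb; case: (ltP al _) => ha; split; lra.
Qed.

(** The roots projected onto the segment, in the coordinate of the line. For a Heun operator the
    default value concerns finitely many n; it makes the size and range conditions of
    [quantile_limit] hold for every n. *)
Definition line_seq Q n : seq R :=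
  let s := poly_roots (spectral_poly k Q n) in
  if size s == n.+1 then [seq clamp (complex.Re ((z - a) / b)) | z <- s]
  else nseq n.+1 al.

Lemma size_line_seq Q n : size (line_seq Q n) = n.+1.
Proof.
by rewrite /line_seq; case: ifP => [/eqP sz|_]; rewrite ?size_map ?sz ?size_nseq.
Qed.

Lemma line_seq_itv Q n x : x \in line_seq Q n -> al <= x <= be.
Proof.
rewrite /line_seq; case: ifP => _; last by rewrite mem_nseq => /andP[_ /eqP ->]; rewrite lexx.
by move=> /mapP[z _ ->]; exact: clamp_itv.
Qed.

Lemma mean_roots_line_seq Q (F : (R[i])^o -> R) (e : R) : heun_operator k Q ->
  Q k = lead_coef (Q k) *: Qm -> continuous F -> 0 < e ->
  exists N, forall n, (N <= n)%N ->
    `|seq_mean (poly_roots (spectral_poly k Q n)) F -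
      seq_mean (line_seq Q n) (fun x => F (a + x%:C * b))| <= e.
Proof.
move=> hQ hQm cF e0; have nb : 0 < normc b by rewrite normc_gt0.
have cA : compact ((fun x : R => (a + x%:C * b) : (R[i])^o) @` `[al, be]).
  apply: continuous_compact; last exact: segment_compact.
  by apply: continuous_subspaceT; exact: continuous_line.
have /nbhs_normP[_ /= /pos_complexP[r r0 ->] hr] := compact_unif_near cF cA e0.
(* Projection then moves a root by at most 2 d |b| = 2 r / 3 < r. *)
pose d := r / (3 * normc b).
have d0 : 0 < d by rewrite divr_gt0 // mulr_gt0.
have db : d * normc b = r / 3 by rewrite /d; field; rewrite gt_eqF.
have [N1 h1] := spectral_roots k0 hQ.
have [N2 h2] := van_vleck_root_line hQ hQm d0.
exists (maxn N1 N2) => n; rewrite geq_max => /andP[n1 n2].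
have [_ sz vv _] := h1 n n1.
rewrite /line_seq sz eqxx seq_mean_map seq_meanB; apply: seq_mean_le; first exact: ltW.
move=> z zs /=; have := h2 n n2 z (vv z zs).
set w := (z - a) / b => -[im re]; set x := clamp _.
have xA : `[al, be]%classic x by rewrite /= in_itv /=; exact: clamp_itv.
have zE : z = (a + x%:C * b) + (w - x%:C) * b.
  by rewrite -addrA -mulrDl addrCA subrr addr0 /w divfK // addrC subrK.
have := hr ((w - x%:C) * b); rewrite {1}zE.
move=> /(_ _ (a + x%:C * b)) h; apply: ltW; apply: h; last by exists x.
rewrite /= sub0r normrN norm_complexE ltcR normcM.
have nw : normc (w - x%:C) <= 2 * d.
  apply: (le_trans (normc_le_ReIm _)); rewrite mulr_natl mulr2n lerD //.
    by rewrite raddfB /=; apply: clamp_dist => //; exact: ltW.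
  by rewrite raddfB /= subr0.
apply: (@le_lt_trans _ _ (2 * d * normc b)); first by rewrite ler_wpM2r // ltW.
by rewrite -mulrA db; lra.
Qed.

(** The number l is chosen before Q: it is the real part of [moment_functional] at a polynomial
    approximating psi, which involves only k, the zeros and the line. This order of quantifiers
    carries the independence from the lower coefficients. *)
Lemma line_mean_approx (psi : R -> R) (e : R) : continuous psi -> 0 < e ->
  exists l, forall Q, heun_operator k Q -> Q k = lead_coef (Q k) *: Qm ->
  exists N, forall n, (N <= n)%N -> `|seq_mean (line_seq Q n) psi - l| <= e.
Proof.
move=> cpsi e0; have e3 : 0 < e / 3 by rewrite divr_gt0.
have [P hP] := weierstrass_approx al be cpsi e3.
(* The polynomial in z whose value at a + x b is P(x). *)
pose W := map_poly (real_complex R) P \Po (b^-1 *: ('X - a%:P)).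
have WE x : complex.Re W.[a + x%:C * b] = P.[x].
  rewrite /W horner_comp hornerZ hornerXsubC addrAC subrr add0r mulrC mulfK //.
  by rewrite horner_map.
exists (complex.Re (moment_functional W)) => Q hQ hQm.
have [N1 h1] := mean_roots_line_seq hQ hQm (@continuous_Re_horner R W) e3.
have /cvgrPdist_le/(_ _ e3)[N2 _ h2] := cvg_mean_roots (P := W) hQ hQm.
exists (maxn N1 N2) => n; rewrite geq_max => /andP[n1 n2].
have {}h1 := h1 n n1; have {}h2 := h2 n n2; rewrite distrC /= in h2.
have h3 : `|seq_mean (line_seq Q n) psi -
    seq_mean (line_seq Q n) (fun x => complex.Re W.[a + x%:C * b])| <= e / 3.
  rewrite seq_meanB; apply: seq_mean_le => [|x xs]; first exact: ltW.
  by rewrite WE; apply: hP; exact: line_seq_itv xs.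
move: h1 h2 h3; rewrite !ler_norml => /andP[a1 a2] /andP[b1 b2] /andP[c1 c2].
by apply/andP; split; lra.
Qed.

Lemma line_mean_cvgn Q (psi : R -> R) : heun_operator k Q ->
  Q k = lead_coef (Q k) *: Qm -> continuous psi ->
  cvgn (fun n => seq_mean (line_seq Q n) psi).
Proof.
move=> hQ hQm cpsi; apply: cvgn_of_approx => e e0.
by have [l /(_ Q hQ hQm)] := line_mean_approx cpsi e0; exists l.
Qed.

Lemma line_mean_cvg Q Q' (psi : R -> R) (l : R) :
  heun_operator k Q -> Q k = lead_coef (Q k) *: Qm ->
  heun_operator k Q' -> Q' k = lead_coef (Q' k) *: Qm -> continuous psi ->
  seq_mean (line_seq Q n) psi @[n --> \oo] --> l ->
  seq_mean (line_seq Q' n) psi @[n --> \oo] --> l.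
Proof.
move=> hQ hQm hQ' hQm' cpsi; apply: cvg_of_approx => e e0.
have [l' h] := line_mean_approx cpsi e0.
have [N hN] := h Q hQ hQm; have [N' hN'] := h Q' hQ' hQm'.
exists l', (maxn N N') => n; rewrite geq_max => /andP[n1 n2].
by split; [exact: hN | exact: hN'].
Qed.

Lemma mean_roots_cvg Q (F : (R[i])^o -> R) (l : R) : heun_operator k Q ->
  Q k = lead_coef (Q k) *: Qm -> continuous F ->
  seq_mean (line_seq Q n) (fun x => F (a + x%:C * b)) @[n --> \oo] --> l ->
  seq_mean (poly_roots (spectral_poly k Q n)) F @[n --> \oo] --> l.
Proof.
move=> hQ hQm cF /cvgrPdist_le hl; apply/cvgrPdist_le => e e0.
have e2 : 0 < e / 2 by rewrite divr_gt0.
have [N h1] := mean_roots_line_seq hQ hQm cF e2.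
have [N' _ h2] := hl _ e2.
exists (maxn N N') => // n /=; rewrite geq_max => /andP[n1 n2].
have {}h1 := h1 n n1; have {}h2 := h2 n n2; rewrite /= in h2.
move: h1 h2; rewrite !ler_norml => /andP[a1 a2] /andP[b1 b2].
by apply/andP; split; lra.
Qed.

Lemma mean_roots_integral : exists g : R -> R, [/\ measurable_fun setT g,
  forall u, al <= g u <= be,
  forall Q, heun_operator k Q -> Q k = lead_coef (Q k) *: Qm ->
    forall F : (R[i])^o -> R, continuous F ->
    (seq_mean (poly_roots (spectral_poly k Q n)) F)%:E @[n --> \oo] -->
    (\int[@lebesgue_measure R]_(u in `[0%R, 1%R[) (F (a + (g u)%:C * b))%:E)%E
  & forall P : {poly R[i]},
    (\int[@lebesgue_measure R]_(u in `[0%R, 1%R[)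
      (complex.Re P.[a + (g u)%:C * b])%:E)%E =
    (complex.Re (moment_functional P))%:E].
Proof.
(* A reference operator, with a monic leading coefficient alone: g is built from it and then serves
   every Q with the same leading zeros. *)
pose Q0 (i : nat) : {poly R[i]} := if i == k then Qm else 0.
have Qm_size : size Qm = k.+2 by rewrite size_prod_XsubC /index_enum -enumT size_enum_ord.
have Q0k : Q0 k = Qm by rewrite /Q0 eqxx.
have hQ0 : heun_operator k Q0.
  split; rewrite ?Q0k // => i _; rewrite /Q0.
  by case: eqP => [->|_]; rewrite ?Qm_size // size_poly0.
have hQm0 : Q0 k = lead_coef (Q0 k) *: Qm.
  have /monicP lc : Qm \is monic by exact: monic_prod_XsubC.
  by rewrite Q0k lc scale1r.
have [g [mg g_itv hg]] := quantile_limit alb (size_line_seq Q0)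
  (fun n => @line_seq_itv Q0 n) (fun psi cpsi => line_mean_cvgn hQ0 hQm0 cpsi).
suff hF : forall Q, heun_operator k Q -> Q k = lead_coef (Q k) *: Qm ->
    forall F : (R[i])^o -> R, continuous F ->
    (seq_mean (poly_roots (spectral_poly k Q n)) F)%:E @[n --> \oo] -->
    (\int[@lebesgue_measure R]_(u in `[0%R, 1%R[) (F (a + (g u)%:C * b))%:E)%E.
  exists g; split=> // P.
  have h1 := hF _ hQ0 hQm0 _ (@continuous_Re_horner R P).
  have h2 := cvg_mean_roots (P := P) hQ0 hQm0.
  have {}h2 : (seq_mean (poly_roots (spectral_poly k Q0 n))
      (fun z => complex.Re P.[z]))%:E @[n --> \oo] -->
      (complex.Re (moment_functional P))%:E.
    by apply: cvg_EFin => //; exact: nearW.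
  exact: (cvg_unique _ h1 h2).
move=> Q hQ hQm F cF.
pose psi x := F (a + x%:C * b).
have cpsi : continuous psi.
  move=> x; apply: (@continuous_comp _ _ _ (fun x : R => (a + x%:C * b) : (R[i])^o)).
    exact: continuous_line.
  exact: cF.
have l0 := line_mean_cvgn hQ0 hQm0 cpsi.
have h0 : (seq_mean (line_seq Q0 n) psi)%:E @[n --> \oo] -->
    (lim (seq_mean (line_seq Q0 n) psi @[n --> \oo]))%:E.
  by apply: cvg_EFin => //; exact: nearW.
rewrite -/psi (cvg_unique _ (hg psi cpsi) h0) //.
apply: cvg_EFin; first exact: nearW.
by apply: mean_roots_cvg => //; exact: line_mean_cvg l0.
Qed.

End Line.

Lemma maxr_subr (R : realDomainType) (x : R) :
  Num.max x 0 - Num.max (- x) 0 = x.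
Proof. by case: (leP x 0) => x0; case: (leP (- x) 0) => y0; lra. Qed.

(** Splits into positive and negative parts, so that formulas for nonnegative integrands suffice. *)
Lemma integral_maxr d (T : measurableType d) (R : realType)
    (m : {measure set T -> \bar R}) (D : set T) (f : T -> R) :
  (\int[m]_(x in D) (f x)%:E)%E =
  (\int[m]_(x in D) (Num.max (f x) 0)%:E -
   \int[m]_(x in D) (Num.max (- f x) 0)%:E)%E.
Proof.
rewrite integralE.
under eq_integral do rewrite funeposE -EFin_max.
by under [X in (_ - X)%E]eq_integral do rewrite funenegE -EFinN -EFin_max.
Qed.

(** * Measures on the complex plane *)

Section BorelComplex.
Variable R : realType.

Lemma continuous_borelC_measurable (F : (R[i])^o -> R) : continuous F ->
  measurable_fun [set: borelC R] (F : borelC R -> R).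
Proof.
move=> /continuousP cF; apply: (measurability _ (RGenOpens.measurableE R)).
move=> _ [_ [x [y ->] <-]]; rewrite setTI.
by apply: sub_sigma_algebra; apply: cF; exact: interval_open.
Qed.

Lemma measurable_borelC_continuous (f : R -> (R[i])^o) : continuous f ->
  measurable_fun [set: R] (f : R -> borelC R).
Proof.
move=> /continuousP cf; apply: (@measurability _ _ _ (borelC R) _ _ (@open (R[i])^o)) => //.
move=> _ [U oU <-]; rewrite setTI.
by apply: open_measurable; exact: cf.
Qed.

Lemma integral_root_counting (p : {poly R[i]}) (F : (R[i])^o -> R) :
  continuous F -> (\int[root_counting_measure p]_z (F z)%:E)%E =
  ((size p).-1%:R^-1 * \sum_(z <- poly_roots p) F z)%:E.
Proof.
move=> cF; have mF := continuous_borelC_measurable cF.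
have ge0_int (G : borelC R -> R) : measurable_fun setT G -> (forall z, 0 <= G z) ->
    (\int[root_counting_measure p]_z (G z)%:E)%E =
    ((size p).-1%:R^-1 * \sum_(z <- poly_roots p) G z)%:E.
  move=> /measurable_EFinP mG G0.
  rewrite /root_counting_measure ge0_integral_mscale //=; last first.
    by move=> z _; rewrite lee_fin.
  rewrite ge0_integral_measure_sum //=; last by move=> z _; rewrite lee_fin.
  under eq_bigr do rewrite integral_dirac // diracT mul1e.
  rewrite sumEFin -EFinM; congr (_ * _)%:E.
  by rewrite (big_nth 0) big_mkord.
rewrite integral_maxr !ge0_int; last 4 first.
- by apply: measurable_maxr; [exact: measurableT_comp | exact: measurable_cst].
- by move=> z; rewrite le_max lexx orbT.
- by apply: measurable_maxr => //; exact: measurable_cst.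
- by move=> z; rewrite le_max lexx orbT.
rewrite -EFinB -mulrBr -sumrB; congr (_ * _)%:E; apply: eq_bigr => z _.
exact: maxr_subr.
Qed.

(** The law of a + g(U) b with U uniform on [0, 1]. The complement of A has an empty preimage, which
    is why g is kept in its interval at every u and not only almost everywhere. *)
Lemma pushforward_line (a b : R[i]) (g : R -> R) : measurable_fun setT g ->
  exists mu : probability (borelC R) R,
  (forall F : (R[i])^o -> R, continuous F -> (\int[mu]_z (F z)%:E)%E =
     (\int[@lebesgue_measure R]_(u in `[0%R, 1%R[) (F (a + (g u)%:C * b))%:E)%E)
  /\ forall A : set (borelC R), (forall u, A (a + (g u)%:C * b)) ->
     mu (~` A) = 0%E.
Proof.
move=> mg; pose X (u : R) : borelC R := a + (g u)%:C * b.
have mX : measurable_fun [set: R] X.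
  apply: (@measurableT_comp _ _ _ _ _ _ (fun x : R => a + x%:C * b : borelC R)) => //.
  by apply: measurable_borelC_continuous; exact: continuous_line.
pose XM : {mfun measurableTypeR R >-> borelC R} :=
  @mfun_Sub _ _ (measurableTypeR R) (borelC R) X (mem_set mX).
exists (distribution (uniform_prob (@ltr01 R)) XM); split=> [F cF|A XA]; last first.
  rewrite /distribution /pushforward /=.
  rewrite (_ : _ @^-1` _ = set0) ?measure0 //.
  by rewrite -subset0 => u /=; apply; exact: XA.
have mF := continuous_borelC_measurable cF.
have ge0_int (G : borelC R -> R) : measurable_fun setT G -> (forall z, 0 <= G z) ->
    (\int[distribution (uniform_prob (@ltr01 R)) XM]_z (G z)%:E)%E =
    (\int[@lebesgue_measure R]_(u in `[0%R, 1%R[) (G (X u))%:E)%E.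
  move=> mG G0; rewrite ge0_integral_distribution; last 2 first.
  - exact/measurable_EFinP.
  - by move=> z; rewrite lee_fin.
  rewrite integral_uniform; last 2 first.
  - by apply/measurable_EFinP/measurableT_comp.
  - by move=> z; rewrite lee_fin.
  rewrite subr0 invr1 mul1e integral_itv_bndo_bndc //.
  by apply/measurable_funTS/measurable_EFinP/measurableT_comp.
rewrite integral_maxr !ge0_int; last 4 first.
- by apply: measurable_maxr; [exact: measurableT_comp | exact: measurable_cst].
- by move=> z; rewrite le_max lexx orbT.
- by apply: measurable_maxr => //; exact: measurable_cst.
- by move=> z; rewrite le_max lexx orbT.
by rewrite [RHS]integral_maxr.
Qed.

End BorelComplex.

(** * Mean and variance for real zeros *)

Section RealMoments.
Variables (R : realType) (k : nat) (xi : 'I_k.+1 -> R[i]) (x : 'I_k.+1 -> R).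
Hypothesis xiE : forall j, xi j = (x j)%:C.

Let xbar := k.+1%:R^-1 * \sum_j x j.

Let sum_xi : \sum_j xi j = (\sum_j x j)%:C.
Proof. by rewrite rmorph_sum; apply: eq_bigr => j _; exact: xiE. Qed.

Let sum_xi2 : \sum_j xi j ^+ 2 = (\sum_j x j ^+ 2)%:C.
Proof. by rewrite rmorph_sum; apply: eq_bigr => j _; rewrite xiE rmorphXn. Qed.

Lemma limit_moment0 (Qm : {poly R[i]}) : limit_moment k Qm 0 = 1.
Proof.
rewrite /limit_moment expr0 muln0 coef1 size_poly1 big_ord_recl big_ord0 coef1.
by rewrite addr0 divr1.
Qed.

Lemma limit_moment1_real :
  limit_moment k (\prod_j ('X - (xi j)%:P)) 1 = xbar%:C.
Proof. by rewrite limit_moment1 sum_xi /xbar mulrC rmorphM fmorphV rmorph_nat. Qed.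

Lemma moment_functional_mean :
  complex.Re (moment_functional xi 'X) = xbar.
Proof.
rewrite /moment_functional; set L := limit_moment k _.
rewrite size_polyX !big_ord_recl big_ord0 !coefX /= mul0r add0r mul1r addr0.
by rewrite /L limit_moment1_real.
Qed.

(** Expanding the square brings in the limit moments of order 0, 1 and 2; what remains is an
    identity between rational functions of k, p1 and p2. *)
Lemma moment_functional_variance : (0 < k)%N ->
  complex.Re (moment_functional xi (('X - (xbar%:C)%:P) ^+ 2)) =
  k%:R / (2 * k + 1)%:R * (k.+1%:R^-1 * \sum_j (x j - xbar) ^+ 2).
Proof.
move=> k0; set p1 := \sum_j x j; set p2 := \sum_j x j ^+ 2.
have K0 : k.+1%:R != 0 :> R by rewrite pnatr_eq0.
have -> : \sum_j (x j - xbar) ^+ 2 = p2 - p1 ^+ 2 / k.+1%:R.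
  under eq_bigr do rewrite sqrrB.
  rewrite big_split sumrB /= -/p2 sumrMnl -mulr_suml -/p1 sumr_const card_ord.
  by rewrite /xbar -/p1 -[_ ^+ 2 *+ k.+1]mulr_natl; field.
rewrite /moment_functional; set L := limit_moment k _.
rewrite size_exp_XsubC !big_ord_recl big_ord0 sqrrB -rmorphXn.
rewrite !(coefD, coefN, coefMn, coefMC, coefXn, coefX, coefC) /=.
rewrite /L limit_moment0 limit_moment1_real limit_moment2 // sum_xi sum_xi2 -/p1 -/p2.
rewrite [X in complex.Re X](_ : _ =
  ((p1 ^+ 2 *+ 2 - p2) / (2 * k).+1%:R - (p1 ^+ 2 - p2) / k.+1%:R - xbar ^+ 2)%:C).
  rewrite /= /xbar -/p1 addn1.
  have K1 : (2 * k).+1%:R != 0 :> R by rewrite pnatr_eq0.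
  move: K0 K1; rewrite !mulrS !natrM; move: (k%:R : R) => K K0 K1.
  by field; rewrite K0 K1.
move: (xbar) (p1) (p2) => y u v.
rewrite !(rmorphB, rmorphD, rmorphM, fmorphV, rmorph_nat, rmorphMn, rmorphXn) /=.
by ring.
Qed.

End RealMoments.

Lemma segment_convex_hull (R : realType) (m : nat) (xi : 'I_m -> R[i]) (a b : R[i])
    (t : 'I_m -> R) (i j : 'I_m) (w : R) :
  (forall l, xi l = a + (t l)%:C * b) -> t i <= w <= t j ->
  convex_hull xi (a + w%:C * b).
Proof.
(* If t i = t j, division by zero gives th = 0, which is right since then w = t i. *)
move=> xiE /andP[iw wj]; pose th := (w - t i) / (t j - t i).
have th_w : th * (t j - t i) = w - t i.
  have [e|ne] := eqVneq (t j - t i) 0; last by rewrite divfK.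
  by rewrite /th e mulr0; lra.
have /andP[th0 th1] : 0 <= th <= 1.
  rewrite /th divr_ge0 ?subr_ge0 ?(le_trans iw) //=.
  have [e|ne] := eqVneq (t j - t i) 0; first by rewrite e invr0 mulr0.
  by rewrite ler_pdivrMr ?mul1r ?lerD2r // lt_neqAle eq_sym ne subr_ge0 (le_trans iw).
clearbody th; exists (fun l => (1 - th) * (l == i)%:R + th * (l == j)%:R); split.
- by move=> l; rewrite addr_ge0 // mulr_ge0 // subr_ge0.
- have sum1 (l : 'I_m) : \sum_(l' < m) (l' == l)%:R = 1 :> R.
    by rewrite (bigD1 l) //= eqxx big1 ?addr0 // => l' /negbTE ->.
  by rewrite big_split /= -!mulr_sumr !sum1; ring.
have sumE (l : 'I_m) (c : R) :
    \sum_(l' < m) (c * (l' == l)%:R)%:C * xi l' = c%:C * xi l.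
  rewrite (bigD1 l) //= eqxx mulr1 big1 ?addr0 // => l' /negbTE ->.
  by rewrite mulr0 mul0r.
under eq_bigr do rewrite rmorphD mulrDl.
rewrite big_split /= !sumE !xiE.
have -> : w = t i + th * (t j - t i) by rewrite th_w; ring.
by rewrite !(rmorphD, rmorphB, rmorphM, rmorph1) /=; ring.
Qed.

Lemma convex_hull_real (R : realType) (m : nat) (xi : 'I_m -> R[i]) (x : 'I_m -> R)
    (z : R[i]) :
  (forall j, xi j = (x j)%:C) -> convex_hull xi z -> z = (complex.Re z)%:C.
Proof.
move=> xiE [t [_ _ ->]].
have -> : \sum_j (t j)%:C * xi j = (\sum_j t j * x j)%:C.
  by rewrite rmorph_sum; apply: eq_bigr => j _; rewrite xiE rmorphM.
by [].
Qed.

Theorem theorem5 (R : realType) (k : nat) (hk : (1 <= k)%N)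
    (Qk : {poly R[i]}) (hQk : size Qk = k.+2)
    (xi : 'I_k.+1 -> R[i])
    (hxi : Qk = lead_coef Qk *: \prod_j ('X - (xi j)%:P))
    (hline : on_affine_line xi) :
  exists mu : probability (borelC R) R,
    [/\ forall Q : nat -> {poly R[i]}, heun_operator k Q -> Q k = Qk ->
          weakly_converges
            (fun n => root_counting_measure (spectral_poly k Q n)) mu,
        mu (~` convex_hull xi) = 0%E
      & forall x : 'I_k.+1 -> R, (forall j, xi j = (x j)%:C) ->
          let xbar := k.+1%:R^-1 * \sum_j x j in
          (\int[mu]_z (complex.Re z)%:E)%E = xbar%:E /\
          (\int[mu]_z ((complex.Re z - xbar) ^+ 2)%:E)%E =
            (k%:R / (2 * k + 1)%:R *
             (k.+1%:R^-1 * \sum_j (x j - xbar) ^+ 2))%:E].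
Proof.
have [a [b [b0 /choice[t xiE]]]] := hline.
(* With the extreme parameters, [t i, t j] parametrizes K_Q itself: its points are convex
   combinations of xi i and xi j. *)
have [i _ mini] := @arg_minP _ R _ ord0 xpredT t isT.
have [j _ maxj] := @arg_maxP _ R _ ord0 xpredT t isT.
have t_itv l : t i <= t l <= t j.
  by apply/andP; split; [exact: mini | exact: maxj].
have [g [mg g_itv hF hP]] := mean_roots_integral hk b0 xiE t_itv.
have [mu [mu_int mu0]] := pushforward_line a b mg.
have hull u : convex_hull xi (a + (g u)%:C * b).
  exact: segment_convex_hull xiE (g_itv u).
exists mu; split.
- move=> Q hQ QkE F cF _; rewrite mu_int //.
  have hQm : Q k = lead_coef (Q k) *: \prod_j ('X - (xi j)%:P) by rewrite QkE.
  apply: cvg_trans (hF Q hQ hQm F cF); apply: near_eq_cvg.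
  have [N hN] := spectral_roots hk hQ; near=> n.
  have [sp sz _ _] : let s := poly_roots (spectral_poly k Q n) in
      [/\ size (spectral_poly k Q n) = n.+2, size s = n.+1,
        {in s, forall x, van_vleck_root k Q n x}
      & forall p, \sum_(x <- s) x ^+ p = \tr (shifted_mx k Q n ^+ p)].
    by apply: hN; near: n; exact: nbhs_infty_ge.
  by rewrite integral_root_counting // /seq_mean sp sz.
- exact: mu0.
- move=> x xE xbar; split.
    rewrite mu_int; last exact: continuous_Re.
    rewrite /xbar -(moment_functional_mean xE) -hP.
    by apply: eq_integral => u _; rewrite hornerX.
  rewrite mu_int; last first.
    move=> z; apply: (@continuous_comp _ _ _ (@complex.Re R : (R[i])^o -> R)
      (fun y => (y - xbar) ^+ 2)); first exact: continuous_Re.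
    apply: (@continuous_comp _ _ _ (fun y => y - xbar) (fun y => y ^+ 2)).
      by apply: cvgB; [exact: cvg_id | exact: cvg_cst].
    exact: exprn_continuous.
  transitivity (complex.Re (moment_functional xi (('X - (xbar%:C)%:P) ^+ 2)))%:E.
    rewrite -hP; apply: eq_integral => u _.
    rewrite horner_exp hornerXsubC.
    (* Even for real zeros a and b come from an arbitrary parametrization of the line. The points of
       the hull are real all the same, so that the real part commutes with the square. *)
    have := convex_hull_real xE (hull u); set z := a + _ => zE.
    by rewrite [in RHS]zE -rmorphB -rmorphXn.
  by rewrite (moment_functional_variance xE).
Unshelve. all: by end_near. Qed.
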